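(* Let $g\in C^\infty([-\pi,\pi])$, and let $G\in C^\infty(T)$ be the unique solution of the classical heat equation $\frac{\partial G}{\partial t}=\frac{\partial^2G}{\partial x^2}$ on $T^0$ with $G_0=g$. Let $\eta,\nu\in{}^{*}\mathbb{N}\setminus\mathbb{N}$ with $\eta\leq\pi\sqrt{2\nu}$, let $f=g_\eta$, and let $F$ be the unique measurable solution of the nonstandard heat equation on $\overline{\mathcal V_\eta}\times\overline{\mathcal T_\nu}$ with initial condition $f$. Then, for all $(x,t)\in\overline{\mathcal V_\eta}\times\overline{\mathcal T_\nu}$ with $t$ finite, $${}^{\circ}F(x,t)=G({}^{\circ}x,{}^{\circ}t).$$
   Context: We work in a nonstandard extension; ${}^{\circ}a$ denotes the standard part of a finite element $a$, and $[\cdot]$ is the integer part. **Classical side.** $C^\infty([-\pi,\pi])$ (resp. $C([-\pi,\pi])$) denotes the functions on $[-\pi,\pi]$ of the form $\theta\mapsto u(e^{i\theta})$ with $u$ smooth (resp. continuous) on the unit circle. $T=[-\pi,\pi]\times\mathbb{R}_{\geq0}$, $T^0=(-\pi,\pi)\times\mathbb{R}_{>0}$, $G_t(x)=G(x,t)$, and $C^\infty(T)=\{G\in C(T):G_t\in C^\infty([-\pi,\pi])\text{ for all }t\in\mathbb{R}_{\geq0},\ G|_{T^0}\in C^\infty(T^0)\}$. For $g\in C^\infty([-\pi,\pi])$ there is a unique $G\in C^\infty(T)$ with $G_0=g$ satisfying $\frac{\partial G}{\partial t}=\frac{\partial^2G}{\partial x^2}$ on $T^0$, namely $G(x,t)=\sum_{m\in\mathbb{Z}}e^{-m^2t}\mathcal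 F(g)(m)e^{imx}$, where $\mathcal F(g)(m)=\frac1{2\pi}\int_{-\pi}^\pi g(x)e^{-imx}dx$. **Nonstandard side.** Let $\overline{\mathcal V_\eta}={}^{*}[-\pi,\pi)$, partitioned into the cells $[-\pi+\pi\frac i\eta,-\pi+\pi\frac{i+1}\eta)$, $0\leq i\leq2\eta-1$, and $\overline{\mathcal T_\nu}=[0,\nu)\subset{}^{*}\mathbb{R}_{\geq0}$, partitioned into the cells $[\frac i\nu,\frac{i+1}\nu)$, $0\leq i\leq\nu^2-1$. A ${}^{*}\mathbb{C}$-valued function on $\overline{\mathcal V_\eta}$, $\overline{\mathcal T_\nu}$ or their product is measurable if it is internal and measurable with respect to the $*$-finite algebra generated by the cells (products of cells); equivalently, internal and constant on each cell. $g_\eta$ is the measurable function on $\overline{\mathcal V_\eta}$ given by $g_\eta(x)={}^{*}g\big(-\pi+\frac\pi\eta[\frac{\eta(x+\pi)}\pi]\big)$. For measurable $h$ on $\overline{\mathcal V_\eta}$, the discrete derivative $h'$ is the unique measurable function with $h'(-\pi+\pi\frac i\eta)=\frac\eta{2\pi}\big(h(-\pi+\pi\frac{i+1}\eta)-h(-\pi+\pi\frac{i-1}\eta)\big)$ for $1\leq i\leq2\eta-2$, $h'(\pi-\frac\pi\eta)=\frac\eta{2\pi}\big(h(-\pi)-h(\pi-\frac{2\pi}\eta)\big)$, $h'(-\pi)=\frac\eta{2\pi}\big(h(-\pi+\frac\pi\eta)-h(\pi-\frac\pi\eta)\big)$. For measurable $F$ of $(x,t)\in\overline{\mathcal V_\eta}\times\overline{\mathcal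 T_\nu}$, $\frac{\partial F}{\partial x}$ is the discrete derivative in $x$ for fixed $t$, $\frac{\partial^2F}{\partial x^2}=\frac\partial{\partial x}\frac{\partial F}{\partial x}$, and $\frac{\partial F}{\partial t}$ is the measurable function with $\frac{\partial F}{\partial t}(x,\frac j\nu)=\nu\big(F(x,\frac{j+1}\nu)-F(x,\frac j\nu)\big)$ for $0\leq j\leq\nu^2-2$, and $\frac{\partial F}{\partial t}(x,\nu-\frac1\nu)=0$. $F$ solves the nonstandard heat equation with initial condition $f$ if $F$ is measurable, $\frac{\partial F}{\partial t}=\frac{\partial^2F}{\partial x^2}$ for all $x\in\overline{\mathcal V_\eta}$ and $t\in\overline{\mathcal T_\nu}\setminus[\nu-\frac1\nu,\nu)$, and $F(x,0)=f(x)$ for $x\in\overline{\mathcal V_\eta}$; such an $F$ exists and is unique for each measurable $f$. *)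

(* Defs.v *)
From Stdlib Require Import Reals Arith.
From Coquelicot Require Import Coquelicot.
Set Implicit Arguments.
Unset Strict Implicit.
Open Scope R_scope.

(** * Nonstandard extensions

    Every set [A] has an extension [star A], every map [f] an extension
    [lift f], and every predicate [P] on [A] an extension [holds P] on
    [star A].  An [n]-ary relation is a predicate on a product, [tup] being the
    identification of [star A * star B] with [star (A * B)].  The laws are the
    inductive clauses of the transfer principle: by induction on a first-order
    formula (over all sets, functions and relations, hence also over power sets
    and function spaces), the extension of the set it defines is defined in
    [star] by the same formula, with quantifiers over [A] becoming quantifiers
    over [star A].  Elements of [star (A -> B)] are the internal functions from
    [star A] to [star B].  Ultrapowers, and more generally limit ultrapowers,
    satisfy these laws. *)

Record nonstandard_extension := {
  star : Type -> Type;
  std : forall A : Type, A -> star A;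
  lift : forall A B : Type, (A -> B) -> star A -> star B;
  tup : forall A B : Type, star A -> star B -> star (A * B);
  holds : forall A : Type, (A -> Prop) -> star A -> Prop;

  lift_id : forall A (a : star A), lift (fun x : A => x) a = a;
  lift_comp : forall A B D (f : A -> B) (g : B -> D) (a : star A),
    lift (fun x => g (f x)) a = lift g (lift f a);
  lift_std : forall A B (f : A -> B) (x : A), lift f (std x) = std (f x);
  lift_fst : forall A B (a : star A) (b : star B), lift fst (tup a b) = a;
  lift_snd : forall A B (a : star A) (b : star B), lift snd (tup a b) = b;
  tup_surj : forall A B (c : star (A * B)), tup (lift fst c) (lift snd c) = c;

  holds_std : forall A (P : A -> Prop) (x : A), holds P (std x) <-> P x;
  holds_lift : forall A B (f : A -> B) (P : B -> Prop) (a : star A),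
    holds P (lift f a) <-> holds (fun x => P (f x)) a;
  holds_eq : forall A (a b : star A),
    holds (fun p : A * A => fst p = snd p) (tup a b) <-> a = b;
  holds_not : forall A (P : A -> Prop) (a : star A),
    holds (fun x => ~ P x) a <-> ~ holds P a;
  holds_and : forall A (P Q : A -> Prop) (a : star A),
    holds (fun x => P x /\ Q x) a <-> holds P a /\ holds Q a;
  holds_exists : forall A B (P : A * B -> Prop) (a : star A),
    holds (fun x => exists y, P (x, y)) a <-> exists b, holds P (tup a b)
}.

Arguments std _ {A} _.
Arguments lift _ {A B} _ _.
Arguments tup _ {A B} _ _.
Arguments holds _ {A} _ _.

Definition lift2 (E : nonstandard_extension) (A B D : Type) (f : A -> B -> D)
    (a : star E A) (b : star E B) : star E D :=
  lift E (fun p => f (fst p) (snd p)) (tup E a b).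

Definition lift3 (E : nonstandard_extension) (A B D H : Type)
    (f : A -> B -> D -> H) (a : star E A) (b : star E B) (d : star E D) :
    star E H :=
  lift2 (fun p => f (fst p) (snd p)) (tup E a b) d.

Definition holds2 (E : nonstandard_extension) (A B : Type)
    (P : A -> B -> Prop) (a : star E A) (b : star E B) : Prop :=
  holds E (fun p => P (fst p) (snd p)) (tup E a b).

Definition holds3 (E : nonstandard_extension) (A B D : Type)
    (P : A -> B -> D -> Prop) (a : star E A) (b : star E B) (d : star E D) :
    Prop :=
  holds2 (fun p => P (fst p) (snd p)) (tup E a b) d.

Definition internal_app (E : nonstandard_extension) (A B : Type)
    (Phi : star E (A -> B)) (a : star E A) : star E B :=
  lift2 (fun f x => f x) Phi a.

(** [n] belongs to *N \ N *)
Definition infinite_nat (E : nonstandard_extension) (n : star E nat) : Prop :=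
  forall k : nat, n <> std E k.

Definition finite_hyperreal (E : nonstandard_extension) (x : star E R) : Prop :=
  exists M : R, holds E (fun y => Rabs y <= M) x.

(** [r] is the standard part of [x]; in particular [x] is finite *)
Definition is_standard_part (E : nonstandard_extension)
    (x : star E R) (r : R) : Prop :=
  forall eps : R, 0 < eps -> holds E (fun y => Rabs (y - r) < eps) x.

Definition is_standard_part_C (E : nonstandard_extension)
    (z : star E C) (c : C) : Prop :=
  forall eps : R, 0 < eps -> holds E (fun w => Cmod (w - c)%C < eps) z.

(** * The classical heat equation *)

Definition is_derive_C (f : R -> C) (x : R) (l : C) : Prop :=
  @is_derive R_AbsRing C_R_NormedModule f x l.

Fixpoint Ck_line (k : nat) (f : R -> C) : Prop :=
  (forall x, continuous f x) /\
  match k with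
  | O => True
  | S k' => exists f', (forall x, is_derive_C f x (f' x)) /\ Ck_line k' f'
  end.

Definition smooth_line (f : R -> C) : Prop := forall k, Ck_line k f.

Fixpoint Ck_plane (k : nat) (U : R * R -> Prop) (f : R * R -> C) : Prop :=
  continuous_on U f /\
  match k with
  | O => True
  | S k' => exists fx ft : R * R -> C,
      (forall x t, U (x, t) ->
         is_derive_C (fun y => f (y, t)) x (fx (x, t)) /\
         is_derive_C (fun s => f (x, s)) t (ft (x, t))) /\
      Ck_plane k' U fx /\ Ck_plane k' U ft
  end.

(** meant for open [U] *)
Definition smooth_plane (U : R * R -> Prop) (f : R * R -> C) : Prop :=
  forall k, Ck_plane k U f.

(** [C^oo([-pi,pi])].  Only the values of [g] on [[-PI, PI]] and those of [u] on
    the unit circle matter; smoothness of [u] on the circle is smoothness in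
    the angular coordinate. *)
Definition Cinf_circle (g : R -> C) : Prop :=
  exists u : C -> C,
    smooth_line (fun th => u (cos th, sin th)) /\
    forall th, - PI <= th <= PI -> g th = u (cos th, sin th).

Definition T_dom (p : R * R) : Prop := - PI <= fst p <= PI /\ 0 <= snd p.
Definition T0_dom (p : R * R) : Prop := - PI < fst p < PI /\ 0 < snd p.

Definition Cinf_T (G : R * R -> C) : Prop :=
  continuous_on T_dom G /\
  (forall t, 0 <= t -> Cinf_circle (fun x => G (x, t))) /\
  smooth_plane T0_dom G.

Definition heat_equation (G : R * R -> C) : Prop :=
  exists Gx Gxx Gt : R * R -> C, forall x t, T0_dom (x, t) ->
    is_derive_C (fun y => G (y, t)) x (Gx (x, t)) /\
    is_derive_C (fun y => Gx (y, t)) x (Gxx (x, t)) /\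
    is_derive_C (fun s => G (x, s)) t (Gt (x, t)) /\
    Gt (x, t) = Gxx (x, t).

Definition classical_solution (g : R -> C) (G : R * R -> C) : Prop :=
  Cinf_T G /\ heat_equation G /\
  forall x, - PI <= x <= PI -> G (x, 0) = g x.

(** * The nonstandard heat equation

    Functions on the nonstandard domains are represented by functions on
    [star E R], of which only the values on the domains matter. *)

Definition in_V (E : nonstandard_extension) (x : star E R) : Prop :=
  holds E (fun y => - PI <= y < PI) x.

Definition in_T (E : nonstandard_extension) (nu : star E nat) (t : star E R) :
    Prop :=
  holds2 (fun n s => 0 <= s < INR n) nu t.

Definition x_node (n i : nat) : R := - PI + PI * (INR i / INR n).
Definition t_node (n j : nat) : R := INR j / INR n.

Definition in_x_cell (E : nonstandard_extension) (eta i : star E nat)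
    (x : star E R) : Prop :=
  holds2 (fun n k => (k <= 2 * n - 1)%nat) eta i /\
  holds3 (fun n k y => x_node n k <= y < x_node n (k + 1)) eta i x.

Definition in_t_cell (E : nonstandard_extension) (nu j : star E nat)
    (t : star E R) : Prop :=
  holds2 (fun n k => (k <= n ^ 2 - 1)%nat) nu j /\
  holds3 (fun n k s => t_node n k <= s < t_node n (k + 1)) nu j t.

Definition measurable_V (E : nonstandard_extension) (eta : star E nat)
    (h : star E R -> star E C) : Prop :=
  (exists Phi : star E (R -> C), forall x, in_V x -> h x = internal_app Phi x) /\
  (forall i x y, in_x_cell eta i x -> in_x_cell eta i y -> h x = h y).

Definition measurable_VT (E : nonstandard_extension) (eta nu : star E nat)
    (F : star E R -> star E R -> star E C) : Prop :=
  (exists Phi : star E (R * R -> C), forall x t, in_V x -> in_T nu t ->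
     F x t = internal_app Phi (tup E x t)) /\
  (forall i j x y s t,
     in_x_cell eta i x -> in_x_cell eta i y ->
     in_t_cell nu j s -> in_t_cell nu j t -> F x s = F y t).

(** the nodes [-pi + pi * i / eta] and [j / nu] *)
Definition star_x_node (E : nonstandard_extension) (eta i : star E nat) :
    star E R := lift2 x_node eta i.
Definition star_t_node (E : nonstandard_extension) (nu j : star E nat) :
    star E R := lift2 t_node nu j.

(** [eta / (2 * pi) * (a - b)] and [nu * (a - b)] *)
Definition x_quotient (E : nonstandard_extension) (eta : star E nat)
    (a b : star E C) : star E C :=
  lift3 (fun n z w => RtoC (INR n / (2 * PI)) * (z - w))%C eta a b.
Definition t_quotient (E : nonstandard_extension) (nu : star E nat)
    (a b : star E C) : star E C :=
  lift3 (fun n z w => RtoC (INR n) * (z - w))%C nu a b.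

(** [h'] is the discrete derivative of [h] *)
Definition is_discrete_derivative (E : nonstandard_extension)
    (eta : star E nat) (h h' : star E R -> star E C) : Prop :=
  let first := std E (- PI) in
  let second := lift E (fun n => - PI + PI / INR n) eta in
  let last := lift E (fun n => PI - PI / INR n) eta in
  let last_but_one := lift E (fun n => PI - 2 * PI / INR n) eta in
  measurable_V eta h' /\
  (forall i : star E nat,
     holds2 (fun n k => (1 <= k <= 2 * n - 2)%nat) eta i ->
     h' (star_x_node eta i) =
       x_quotient eta (h (star_x_node eta (lift E (fun k => k + 1)%nat i)))
                      (h (star_x_node eta (lift E (fun k => k - 1)%nat i)))) /\
  h' last = x_quotient eta (h first) (h last_but_one) /\
  h' first = x_quotient eta (h second) (h last).

Definition is_partial_x (E : nonstandard_extension) (eta nu : star E nat)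
    (F F' : star E R -> star E R -> star E C) : Prop :=
  forall t, in_T nu t ->
    is_discrete_derivative eta (fun x => F x t) (fun x => F' x t).

Definition is_partial_t (E : nonstandard_extension) (eta nu : star E nat)
    (F F' : star E R -> star E R -> star E C) : Prop :=
  measurable_VT eta nu F' /\
  forall x, in_V x ->
    (forall j : star E nat,
       holds2 (fun n k => (k <= n ^ 2 - 2)%nat) nu j ->
       F' x (star_t_node nu j) =
         t_quotient nu (F x (star_t_node nu (lift E (fun k => k + 1)%nat j)))
                       (F x (star_t_node nu j))) /\
    F' x (lift E (fun n => INR n - 1 / INR n) nu) = std E (RtoC 0).

(** The discrete partial derivatives of a measurable function exist and are
    unique on the domain, so quantifying existentially over them is the same as
    referring to them. *)
Definition nonstandard_solution (E : nonstandard_extension)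
    (eta nu : star E nat) (f : star E R -> star E C)
    (F : star E R -> star E R -> star E C) : Prop :=
  measurable_VT eta nu F /\
  (exists Fx Fxx Ft : star E R -> star E R -> star E C,
     is_partial_x eta nu F Fx /\ is_partial_x eta nu Fx Fxx /\
     is_partial_t eta nu F Ft /\
     forall x t, in_V x -> in_T nu t ->
       ~ holds2 (fun n s => INR n - 1 / INR n <= s < INR n) nu t ->
       Ft x t = Fxx x t) /\
  (forall x, in_V x -> F x (std E 0) = f x).

(** [g_eta]; [IZR (Int_part r)] is the integer part of [r]. *)
Definition discretization (E : nonstandard_extension) (eta : star E nat)
    (g : R -> C) (x : star E R) : star E C :=
  lift E g
    (lift2 (fun n y =>
              - PI + PI / INR n * IZR (Int_part (INR n * (y + PI) / PI)))
           eta x).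

(* Main.v *)
Require Import Defs.
From Stdlib Require Import Reals Lra Lia ZArith Classical ClassicalEpsilon.
From Stdlib Require Import FunctionalExtensionality PropExtensionality.
From Coquelicot Require Import Coquelicot.
Open Scope R_scope.

(** At the nodes, [F] is the solution of an explicit finite difference scheme
    with centred step [2 h], [h = PI / eta], and mesh ratio
    [lam = eta^2 / (4 PI^2 nu)]; the hypothesis [eta <= PI sqrt (2 nu)] says
    [lam <= 1/2], which gives the scheme a maximum principle.  By transfer it is
    enough to prove convergence of the standard scheme.

    The maximum principle, applied to translates and differences of the discrete
    solution [U], bounds its first and second differences by those of [g].
    Compare [U] with [G] through a maximum point of
    [U - G - 3 delta t - delta x^2].  Near [t = 0] the error is small because [U]
    is uniformly Lipschitz in time.  Near an interior point the smoothness of [G]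
    and the scheme contradict [G_t = G_xx].  Near [x = PI ~ - PI], where nothing
    is known about [G] beyond continuity and smoothness of each [G_t], the convex
    kink of [- delta x^2] excludes a maximum.  Compactness makes these local
    statements uniform. *)

(** * The explicit scheme on the circle *)

Definition second_difference (f : R -> R) (x k : R) : R :=
  f (x + k) + f (x - k) - 2 * f x.

(** The mean value theorem is applied twice: to [y => f (y + k) - f y] on [[x - k, x]], then to [f']
    on the resulting [[y, y + k]]. *)
Lemma second_difference_mvt (f f' f'' : R -> R) (x k : R) :
  0 < k ->
  (forall y, x - k <= y <= x + k -> is_derive f y (f' y)) ->
  (forall y, x - k <= y <= x + k -> is_derive f' y (f'' y)) ->
  exists z, x - k <= z <= x + k /\ second_difference f x k = k ^ 2 * f'' z.
Proof.
  intros hk hf hf'.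
  destruct (MVT_cor2 (fun y => f (y + k) - f y) (fun y => f' (y + k) - f' y) (x - k) x)
    as [y [ey hy]]; [lra | |].
  - intros c hc. apply is_derive_Reals.
    apply (is_derive_minus (fun y => f (y + k)) f); [|apply hf; lra].
    replace (f' (c + k)) with (scal 1 (f' (c + k))) by (unfold scal; simpl; unfold mult; simpl; ring).
    apply (is_derive_comp f (fun y => y + k)).
    + apply hf; lra.
    + auto_derive; auto; ring.
  - destruct (MVT_cor2 f' f'' y (y + k)) as [z [ez hz]]; [lra | |].
    + intros c hc. apply is_derive_Reals, hf'. lra.
    + exists z. split; [lra|].
      unfold second_difference.
      replace (x - k + k) with x in ey by ring.
      replace (y + k - y) with k in ez by ring.
      replace (x - (x - k)) with k in ey by ring.
      rewrite ez in ey. lra.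
Qed.

Lemma second_difference_opp (f : R -> R) (x k : R) :
  second_difference f x (- k) = second_difference f x k.
Proof. unfold second_difference, Rminus. rewrite Ropp_involutive. ring. Qed.

Lemma periodic_shift (f : R -> R) (T : R) :
  (forall x, f (x + T) = f x) -> forall (k : Z) x, f (x + IZR k * T) = f x.
Proof.
  intros hf.
  assert (hn : forall (n : nat) x, f (x + INR n * T) = f x).
  { induction n as [|n IH]; intros x.
    - simpl. f_equal; ring.
    - rewrite S_INR. replace (x + (INR n + 1) * T) with (x + INR n * T + T) by ring.
      rewrite hf. apply IH. }
  intros k x. destruct (Z_le_gt_dec 0 k) as [hk|hk].
  - rewrite <- (Z2Nat.id k hk), <- INR_IZR_INZ. apply hn.
  - rewrite <- (hn (Z.to_nat (- k)) (x + IZR k * T)).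
    rewrite INR_IZR_INZ, Z2Nat.id by lia. rewrite opp_IZR. f_equal; ring.
Qed.

Lemma periodic_bounded (f : R -> R) (T : R) :
  0 < T -> (forall x, f (x + T) = f x) -> (forall x, continuous f x) ->
  exists M, forall x, Rabs (f x) <= M.
Proof.
  intros hT hper hcont.
  destruct (continuity_ab_maj (fun x => Rabs (f x)) 0 T) as [xm [hm _]].
  - lra.
  - intros c _. apply continuity_pt_filterlim.
    apply (continuous_comp f Rabs); [apply hcont | apply continuous_Rabs].
  - exists (Rabs (f xm)). intros x.
    destruct (base_Int_part (x / T)) as [h1 h2].
    rewrite <- (periodic_shift f T hper (- Int_part (x / T)) x).
    apply hm. rewrite opp_IZR.
    assert (e : x = x / T * T) by (field; lra).
    rewrite e at 1 3. split; nra.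
Qed.

(** The two quotient bounds stand in for bounds on the first two derivatives. They are bounds on
    differences of translates, so the scheme preserves them, and they make sense without
    differentiating the iterates. *)
Definition tame (q : R -> R) (C : R) : Prop :=
  (forall x, q (x + 2 * PI) = q x) /\
  (forall x k, Rabs (q (x + k) - q x) <= C * Rabs k) /\
  (forall x k, Rabs (second_difference q x k) <= C * k ^ 2).

Lemma tame_nonneg (q : R -> R) (C : R) : tame q C -> 0 <= C.
Proof.
  intros [_ [h _]]. specialize (h 0 1). rewrite (Rabs_pos_eq 1) in h by lra.
  pose proof (Rabs_pos (q (0 + 1) - q 0)). lra.
Qed.

Lemma tame_ext (p q : R -> R) (C : R) : (forall x, p x = q x) -> tame q C -> tame p C.
Proof.
  intros e. assert (p = q) as -> by now apply functional_extensionality. auto.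
Qed.

Lemma tame_opp (q : R -> R) (C : R) : tame q C -> tame (fun x => - q x) C.
Proof.
  intros [h0 [h1 h2]]. split; [|split].
  - intros x. now rewrite h0.
  - intros x k. rewrite <- Rabs_Ropp.
    replace (- (- q (x + k) - - q x)) with (q (x + k) - q x) by ring. apply h1.
  - intros x k. rewrite <- Rabs_Ropp.
    replace (- second_difference (fun x => - q x) x k) with (second_difference q x k)
      by (unfold second_difference; ring). apply h2.
Qed.

Lemma is_derive_periodic (f f' : R -> R) (T : R) :
  (forall x, f (x + T) = f x) -> (forall x, is_derive f x (f' x)) ->
  forall x, f' (x + T) = f' x.
Proof.
  intros hper hf x.
  rewrite <- (is_derive_unique f x (f' x) (hf x)).
  symmetry. apply is_derive_unique.
  apply (is_derive_ext (fun y => f (y + T))); [exact hper|].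
  replace (f' (x + T)) with (scal 1 (f' (x + T))) by (unfold scal; simpl; unfold mult; simpl; ring).
  apply (is_derive_comp f (fun y => y + T)).
  - apply hf.
  - auto_derive; auto; ring.
Qed.

(** Periodicity passes to [q'] and [q'']; being continuous, they are bounded, and mean value
    theorems turn these bounds into quotient bounds. *)
Lemma tame_of_derivatives (q q' q'' : R -> R) :
  (forall x, q (x + 2 * PI) = q x) ->
  (forall x, is_derive q x (q' x)) -> (forall x, is_derive q' x (q'' x)) ->
  (forall x, continuous q'' x) -> exists C, tame q C.
Proof.
  intros hper hq hq' hc.
  pose proof PI_RGT_0 as hpi.
  destruct (periodic_bounded q' (2 * PI)) as [M1 hM1]; [lra | | |].
  { now apply (is_derive_periodic q). }
  { intros x. apply (ex_derive_continuous q'). eexists; apply hq'. }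
  destruct (periodic_bounded q'' (2 * PI)) as [M2 hM2]; [lra | | exact hc |].
  { apply (is_derive_periodic q'); [|exact hq']. now apply (is_derive_periodic q). }
  exists (Rmax M1 M2). split; [exact hper | split].
  - intros x k.
    destruct (MVT_gen q x (x + k) q') as [c [_ ec]].
    + intros; apply hq.
    + intros y _. apply continuity_pt_filterlim, (ex_derive_continuous q).
      eexists; apply hq.
    + rewrite ec, Rabs_mult. replace (x + k - x) with k by ring.
      apply Rmult_le_compat_r; [apply Rabs_pos|].
      eapply Rle_trans; [apply hM1 | apply Rmax_l].
  - assert (hpos : forall x k, 0 < k ->
        Rabs (second_difference q x k) <= Rmax M1 M2 * k ^ 2).
    { intros x k hk.
      destruct (second_difference_mvt q q' q'' x k) as [z [_ ez]]; auto.
      rewrite ez, Rabs_mult, (Rabs_pos_eq (k ^ 2)) by nra.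
      rewrite Rmult_comm. apply Rmult_le_compat_r; [nra|].
      eapply Rle_trans; [apply hM2 | apply Rmax_r]. }
    intros x k. destruct (Rtotal_order k 0) as [hk|[hk|hk]].
    + rewrite <- second_difference_opp. replace (k ^ 2) with ((- k) ^ 2) by ring.
      apply hpos; lra.
    + subst k. unfold second_difference. rewrite Rplus_0_r, Rminus_0_r.
      replace (q x + q x - 2 * q x) with 0 by ring. rewrite Rabs_R0. lra.
    + now apply hpos.
Qed.

(** The step is [2 * h] because a centred quotient of step [h] on each side is applied twice. Space
    is the whole line rather than a grid, so that arbitrary translates are again solutions. *)
Definition explicit_scheme (lam h : R) (U : nat -> R -> R) : Prop :=
  forall j x, U (S j) x = U j x + lam * second_difference (U j) x (2 * h).

Lemma scheme_opp lam h U :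
  explicit_scheme lam h U -> explicit_scheme lam h (fun j x => - U j x).
Proof. intros hU j x. rewrite hU. unfold second_difference. ring. Qed.

(** For [lam <= 1 / 2] the new value is a convex combination of three old ones, with weights
    [1 - 2 * lam], [lam], [lam]. This is the discrete maximum principle. *)
Lemma scheme_bound lam h U M :
  0 <= lam <= 1 / 2 -> explicit_scheme lam h U ->
  (forall x, Rabs (U O x) <= M) -> forall j x, Rabs (U j x) <= M.
Proof.
  intros hl hU h0 j. induction j as [|j IH]; [exact h0|].
  intros x. rewrite hU. unfold second_difference.
  pose proof (IH x) as a. pose proof (IH (x + 2 * h)) as b. pose proof (IH (x - 2 * h)) as c.
  apply Rabs_le_between in a, b, c. apply Rabs_le_between.
  split; nra.
Qed.

Lemma scheme_periodic lam h U T :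
  explicit_scheme lam h U -> (forall x, U O (x + T) = U O x) ->
  forall j x, U j (x + T) = U j x.
Proof.
  intros hU h0 j. induction j as [|j IH]; [exact h0|].
  intros x. rewrite !hU. unfold second_difference.
  replace (x + T + 2 * h) with (x + 2 * h + T) by ring.
  replace (x + T - 2 * h) with (x - 2 * h + T) by ring.
  now rewrite !IH.
Qed.

(* Translates and differences of a solution of the scheme are again solutions,
   so the maximum principle propagates the bounds on the initial datum. *)
Lemma scheme_tame lam h U C :
  0 <= lam <= 1 / 2 -> explicit_scheme lam h U ->
  tame (U O) C -> forall j, tame (U j) C.
Proof.
  intros hl hU [h0 [h1 h2]] j. split; [|split].
  - now apply (scheme_periodic lam h).
  - intros x k. revert j x.
    apply (scheme_bound lam h (fun j x => U j (x + k) - U j x)); auto.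
    intros j x. rewrite !hU. unfold second_difference.
    replace (x + k + 2 * h) with (x + 2 * h + k) by ring.
    replace (x + k - 2 * h) with (x - 2 * h + k) by ring. ring.
  - intros x k. revert j x.
    apply (scheme_bound lam h (fun j x => second_difference (U j) x k)); auto.
    intros j x. unfold second_difference. rewrite !hU. unfold second_difference.
    replace (x + k + 2 * h) with (x + 2 * h + k) by ring.
    replace (x + k - 2 * h) with (x - 2 * h + k) by ring.
    replace (x - k + 2 * h) with (x + 2 * h - k) by ring.
    replace (x - k - 2 * h) with (x - 2 * h - k) by ring. ring.
Qed.

(** Each step adds [lam] times a second difference, which tameness bounds at every level. For the
    mesh ratio used below, [lam * (2 * h) ^ 2] is the time step, so the bound is [C] times the
    elapsed time. *)
Lemma scheme_time_lipschitz lam h U C :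
  0 <= lam <= 1 / 2 -> explicit_scheme lam h U -> tame (U O) C ->
  forall j x, Rabs (U j x - U O x) <= INR j * (lam * (2 * h) ^ 2) * C.
Proof.
  intros hl hU ht j x. induction j as [|j IH].
  - replace (U O x - U O x) with 0 by ring. rewrite Rabs_R0. simpl. lra.
  - destruct (scheme_tame lam h U C hl hU ht j) as [_ [_ h2]].
    specialize (h2 x (2 * h)). rewrite hU, S_INR.
    apply Rabs_le_between in h2, IH. apply Rabs_le_between.
    split; nra.
Qed.

(** * Comparison with the classical solution *)

Definition continuous_at_within (D : R * R -> Prop) (f : R -> R -> R) (a b : R) : Prop :=
  forall eps, 0 < eps -> exists r, 0 < r /\
    forall x t, D (x, t) -> Rabs (x - a) < r -> Rabs (t - b) < r ->
      Rabs (f x t - f a b) < eps.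

(** The real-valued properties of [G] that the comparison uses. Differentiability in time is
    available only in the interior; across the seam [PI ~ - PI] each time slice agrees with a tame
    periodic function, with a constant that may vary with [t] without control. *)
Record periodic_heat_solution (G Gt Gx Gxx : R -> R -> R) : Prop := {
  phs_cont : forall a b, T_dom (a, b) -> continuous_at_within T_dom G a b;
  phs_space : forall t, 0 <= t ->
    exists q C, tame q C /\ forall x, - PI <= x <= PI -> G x t = q x;
  phs_dt : forall x t, T0_dom (x, t) -> is_derive (fun s => G x s) t (Gt x t);
  phs_dx : forall x t, T0_dom (x, t) -> is_derive (fun y => G y t) x (Gx x t);
  phs_dxx : forall x t, T0_dom (x, t) -> is_derive (fun y => Gx y t) x (Gxx x t);
  phs_eq : forall x t, T0_dom (x, t) -> Gt x t = Gxx x t;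
  phs_cont_dt : forall a b, T0_dom (a, b) -> continuous_at_within T0_dom Gt a b;
  phs_cont_dxx : forall a b, T0_dom (a, b) -> continuous_at_within T0_dom Gxx a b
}.

Lemma periodic_heat_solution_opp G Gt Gx Gxx :
  periodic_heat_solution G Gt Gx Gxx ->
  periodic_heat_solution (fun x t => - G x t) (fun x t => - Gt x t)
    (fun x t => - Gx x t) (fun x t => - Gxx x t).
Proof.
  assert (hc : forall D f a b, continuous_at_within D f a b ->
                 continuous_at_within D (fun x t => - f x t) a b).
  { intros D f a b h eps he. destruct (h eps he) as [r [hr h']].
    exists r. split; [exact hr|]. intros x t hd hx ht.
    rewrite <- Rabs_Ropp. replace (- (- f x t - - f a b)) with (f x t - f a b) by ring. auto. }
  intros [h1 h2 h3 h4 h5 h6 h7 h8]. split.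
  - intros a b h. apply hc; auto.
  - intros t ht. destruct (h2 t ht) as [q [C [hq e]]].
    exists (fun x => - q x), C. split; [now apply tame_opp|].
    intros x hx. now rewrite e.
  - intros x t h. apply (is_derive_opp (fun s => G x s)). auto.
  - intros x t h. apply (is_derive_opp (fun y => G y t)). auto.
  - intros x t h. apply (is_derive_opp (fun y => Gx y t)). auto.
  - intros x t h. now rewrite h6.
  - intros a b h. apply hc; auto.
  - intros a b h. apply hc; auto.
Qed.

(** * The penalized error and the location of its maxima *)

Definition mesh_ratio (n m : nat) : R := INR n ^ 2 / (4 * PI ^ 2 * INR m).

Lemma mesh_ratio_step (n m : nat) :
  0 < INR n -> 0 < INR m -> mesh_ratio n m * (2 * (PI / INR n)) ^ 2 = 1 / INR m.
Proof. intros hn hm. unfold mesh_ratio. pose proof PI_RGT_0. field. lra. Qed.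

Lemma mesh_ratio_pos (n m : nat) : 0 < INR n -> 0 < INR m -> 0 < mesh_ratio n m.
Proof.
  intros hn hm. unfold mesh_ratio. pose proof PI_RGT_0.
  apply Rdiv_lt_0_compat; [nra|]. apply Rmult_lt_0_compat; [nra | exact hm].
Qed.

Lemma mesh_ratio_cfl (n m : nat) :
  0 < INR m -> INR n <= PI * sqrt (2 * INR m) -> mesh_ratio n m <= 1 / 2.
Proof.
  intros hm h. pose proof PI_RGT_0. pose proof (pos_INR n) as hn.
  assert (hs : sqrt (2 * INR m) ^ 2 = 2 * INR m) by (apply pow2_sqrt; lra).
  assert (h2 : INR n ^ 2 <= (PI * sqrt (2 * INR m)) ^ 2) by (apply pow_incr; lra).
  rewrite Rpow_mult_distr, hs in h2.
  unfold mesh_ratio. apply Rle_div_l; [|lra].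
  apply Rmult_lt_0_compat; [nra | exact hm].
Qed.

(** The second difference of [delta * x ^ 2] costs [2 * delta] in the discrete equation; the
    coefficient [3 * delta] in time outweighs it and leaves a strict [- delta]. *)
Definition penalized_error (G : R -> R -> R) (U : nat -> R -> R) (delta : R)
    (m j : nat) (x : R) : R :=
  U j x - G x (INR j / INR m) - 3 * delta * (INR j / INR m) - delta * x ^ 2.

Definition is_maximum (v : nat -> R -> R) (J j : nat) (x : R) : Prop :=
  (j <= J)%nat /\ - PI <= x <= PI /\
  forall i y, (i <= J)%nat -> - PI <= y <= PI -> v i y <= v j x.

(** A local statement at [(a, b)]: the single number [d] is both the radius of the neighbourhood and
    the bound on the mesh sizes, so that a compactness argument can make both uniform. *)
Definition no_large_maximum (G : R -> R -> R) (q : R -> R) (delta eps a b : R) : Prop :=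
  exists d, 0 < d /\ forall n m U J j x,
    1 / d <= INR n -> 1 / d <= INR m -> mesh_ratio n m <= 1 / 2 ->
    explicit_scheme (mesh_ratio n m) (PI / INR n) U ->
    (forall y, U O y = q y) ->
    is_maximum (penalized_error G U delta m) J j x ->
    Rabs (x - a) < d -> Rabs (INR j / INR m - b) < d ->
    penalized_error G U delta m j x <= eps.

Lemma inv_le_pos d z : 0 < d -> 1 / d <= z -> 0 < z /\ 1 / z <= d.
Proof.
  intros hd h.
  assert (0 < 1 / d) by (apply Rdiv_lt_0_compat; lra).
  assert (hz : 0 < z) by lra. split; [exact hz|].
  apply Rle_div_l; [exact hz|]. apply Rle_div_l in h; [lra | exact hd].
Qed.

Lemma no_large_maximum_initial G q C delta eps a :
  continuous_at_within T_dom G a 0 ->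
  - PI <= a <= PI -> tame q C -> (forall x, - PI <= x <= PI -> G x 0 = q x) ->
  0 < delta -> 0 < eps -> no_large_maximum G q delta eps a 0.
Proof.
  intros hG ha hq hq0 hdelta heps.
  pose proof (tame_nonneg q C hq) as hC.
  destruct (hG (eps / 3)) as [r [hr hcl]]; [lra|].
  (* Within [r] the values of [G] at times [0] and [t] are each [eps / 3]-close to [G a 0]. The
     second entry makes the drift [C * t] of [U] at most [eps / 3]; [C + 1] avoids division by
     zero. *)
  exists (Rmin r (eps / (3 * (C + 1)))).
  assert (he : 0 < eps / (3 * (C + 1))) by (apply Rdiv_lt_0_compat; lra).
  split; [now apply Rmin_pos|].
  set (d := Rmin _ _). assert (hd : 0 < d) by (now apply Rmin_pos).
  assert (hd1 : d <= r) by apply Rmin_l.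
  assert (hd2 : d <= eps / (3 * (C + 1))) by apply Rmin_r.
  intros n m U J j x hn hm hl hU hU0 [hj [hx _]] hxa hjb.
  destruct (inv_le_pos d _ hd hn) as [hn0 _].
  destruct (inv_le_pos d _ hd hm) as [hm0 _].
  pose proof (tame_ext (U O) q C hU0 hq) as htU.
  pose proof (mesh_ratio_pos n m hn0 hm0) as hl0.
  pose proof (scheme_time_lipschitz _ _ U C (conj (Rlt_le _ _ hl0) hl) hU htU j x) as hlip.
  rewrite mesh_ratio_step in hlip by assumption.
  replace (INR j * (1 / INR m)) with (INR j / INR m) in hlip by (field; lra).
  rewrite Rminus_0_r in hjb.
  assert (ht : 0 <= INR j / INR m).
  { apply Rdiv_le_0_compat; [apply pos_INR | exact hm0]. }
  rewrite Rabs_pos_eq in hjb by exact ht.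
  rewrite hU0, <- hq0 in hlip by exact hx.
  assert (k1 : Rabs (G x (INR j / INR m) - G a 0) < eps / 3).
  { apply hcl; [split; simpl; lra | lra |]. rewrite Rminus_0_r, Rabs_pos_eq by exact ht. lra. }
  assert (k2 : Rabs (G x 0 - G a 0) < eps / 3).
  { apply hcl; [split; simpl; lra | lra |]. rewrite Rminus_0_r, Rabs_R0. lra. }
  assert (k3 : INR j / INR m * C <= eps / 3).
  { assert (e : eps / (3 * (C + 1)) * (C + 1) = eps / 3) by (field; lra). nra. }
  apply Rabs_le_between in hlip. apply Rabs_lt_between in k1, k2.
  unfold penalized_error. pose proof (pow2_ge_0 x). nra.
Qed.

(* At an interior maximum the scheme would force [G_t - G_xx <= - delta] at nearby points. *)
Lemma no_large_maximum_interior G Gt Gx Gxx q delta eps a b :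
  periodic_heat_solution G Gt Gx Gxx -> T0_dom (a, b) ->
  0 < delta -> no_large_maximum G q delta eps a b.
Proof.
  intros hG hab hdelta. pose proof PI_RGT_0 as hpi. pose proof PI_4 as hpi4.
  destruct (phs_cont_dt _ _ _ _ hG a b hab (delta / 2)) as [r1 [hr1 c1]]; [lra|].
  destruct (phs_cont_dxx _ _ _ _ hG a b hab (delta / 2)) as [r2 [hr2 c2]]; [lra|].
  destruct hab as [ha hb]; simpl in ha, hb.
  (* The [r]-neighbourhood of [(a, b)] lies inside the open domain and within both continuity
     radii. *)
  set (r := Rmin (Rmin r1 r2) (Rmin b (Rmin (PI - a) (a + PI)))).
  assert (hr : 0 < r) by (repeat apply Rmin_pos; lra).
  assert (r <= r1) by (unfold r; eapply Rle_trans; [apply Rmin_l | apply Rmin_l]).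
  assert (r <= r2) by (unfold r; eapply Rle_trans; [apply Rmin_l | apply Rmin_r]).
  assert (r <= b) by (unfold r; eapply Rle_trans; [apply Rmin_r | apply Rmin_l]).
  assert (r <= PI - a) by (unfold r; eapply Rle_trans; [apply Rmin_r |
    eapply Rle_trans; [apply Rmin_r | apply Rmin_l]]).
  assert (r <= a + PI) by (unfold r; eapply Rle_trans; [apply Rmin_r |
    eapply Rle_trans; [apply Rmin_r | apply Rmin_r]]).
  assert (hin : forall x t, Rabs (x - a) < r -> Rabs (t - b) < r -> T0_dom (x, t)).
  { intros x t hx ht. apply Rabs_lt_between in hx, ht. split; simpl; lra. }
  (* The factor 16 leaves room for the whole stencil: since [PI <= 4], [h <= r / 4], so [x - 2 * h],
     [x + 2 * h] and the preceding time level stay within [r] of [(a, b)]. *)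
  exists (r / 16). split; [lra|].
  intros n m U J j x hn hm hl hU _ [hj [hx hmax]] hxa hjb. exfalso.
  destruct (inv_le_pos (r / 16) _ ltac:(lra) hn) as [hn0 hn1].
  destruct (inv_le_pos (r / 16) _ ltac:(lra) hm) as [hm0 hm1].
  apply Rabs_lt_between in hxa, hjb.
  (* Level [0] is too far from [b], so a preceding level exists. *)
  destruct j as [|j].
  { simpl in hjb. unfold Rdiv in hjb. rewrite Rmult_0_l in hjb. lra. }
  set (h := PI / INR n) in *. set (lam := mesh_ratio n m) in *.
  assert (hh : 0 < h) by (apply Rdiv_lt_0_compat; lra).
  assert (hh' : h <= r / 4).
  { unfold h. replace (PI / INR n) with (PI * (1 / INR n)) by (field; lra). nra. }
  assert (hl0 : 0 < lam) by now apply mesh_ratio_pos.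
  assert (hstep : lam * (2 * h) ^ 2 = 1 / INR m) by now apply mesh_ratio_step.
  assert (et : INR (S j) / INR m = INR j / INR m + 1 / INR m).
  { rewrite S_INR. field. lra. }
  set (t := INR j / INR m) in *. set (k := 1 / INR m) in *.
  assert (hk : 0 < k) by (apply Rdiv_lt_0_compat; lra).
  rewrite et in hjb.
  assert (mx : forall y, - PI <= y <= PI ->
     penalized_error G U delta m j y <= penalized_error G U delta m (S j) x).
  { intros y hy. apply hmax; [lia | exact hy]. }
  pose proof (mx x hx) as m0.
  pose proof (mx (x + 2 * h) ltac:(lra)) as mp.
  pose proof (mx (x - 2 * h) ltac:(lra)) as mm.
  unfold penalized_error in m0, mp, mm. rewrite et in m0, mp, mm. fold t in m0, mp, mm.
  rewrite hU in m0, mp, mm.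
  destruct (MVT_cor2 (fun s => G x s) (fun s => Gt x s) t (t + k)) as [s [es hs]].
  { lra. }
  { intros c hc. apply is_derive_Reals, (phs_dt _ _ _ _ hG).
    apply hin; apply Rabs_lt_between; lra. }
  replace (t + k - t) with k in es by ring.
  destruct (second_difference_mvt (fun y => G y t) (fun y => Gx y t) (fun y => Gxx y t) x (2 * h))
    as [z [hz ez]].
  { lra. }
  { intros y hy. apply (phs_dx _ _ _ _ hG). apply hin; apply Rabs_lt_between; lra. }
  { intros y hy. apply (phs_dxx _ _ _ _ hG). apply hin; apply Rabs_lt_between; lra. }
  assert (hxs : Rabs (x - a) < r) by (apply Rabs_lt_between; lra).
  assert (hss : Rabs (s - b) < r) by (apply Rabs_lt_between; lra).
  assert (hzs : Rabs (z - a) < r) by (apply Rabs_lt_between; lra).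
  assert (hts : Rabs (t - b) < r) by (apply Rabs_lt_between; lra).
  pose proof (c1 x s (hin _ _ hxs hss) ltac:(lra) ltac:(lra)) as k1.
  pose proof (c2 z t (hin _ _ hzs hts) ltac:(lra) ltac:(lra)) as k2.
  assert (hT : T0_dom (a, b)) by (split; simpl; lra).
  rewrite (phs_eq _ _ _ _ hG a b hT) in k1.
  apply Rabs_lt_between in k1, k2.
  assert (key : Gt x s - Gxx z t <= - delta); [|lra].
  unfold second_difference in m0, mp, mm, ez.
  assert (ez' : lam * (G (x + 2 * h) t + G (x - 2 * h) t - 2 * G x t) = k * Gxx z t).
  { rewrite ez, <- hstep. ring. }
  apply Rmult_le_reg_l with k; [exact hk|].
  set (A := U j x) in *. set (B := U j (x + 2 * h)) in *. set (D := U j (x - 2 * h)) in *.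
  set (S0 := G x t) in *. set (S1 := G (x + 2 * h) t) in *. set (S2 := G (x - 2 * h) t) in *.
  set (S3 := G x (t + k)) in *.
  set (V := A + lam * (B + D - 2 * A) - S3 - 3 * delta * (t + k) - delta * x ^ 2) in *.
  (* The three comparisons with the preceding level are averaged with the weights of the scheme. The
     values of [U] then cancel, and only differences of [G] and of the penalty remain. *)
  assert (w : (1 - 2 * lam) * (A - S0 - 3 * delta * t - delta * x ^ 2)
    + lam * (B - S1 - 3 * delta * t - delta * (x + 2 * h) ^ 2)
    + lam * (D - S2 - 3 * delta * t - delta * (x - 2 * h) ^ 2)
    <= (1 - 2 * lam) * V + lam * V + lam * V).
  { apply Rplus_le_compat; [apply Rplus_le_compat|]; apply Rmult_le_compat_l; lra. }
  unfold V in w.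
  assert (e2 : delta * (lam * (2 * h) ^ 2) = delta * k) by (rewrite hstep; ring).
  nra.
Qed.

(* Across [x = PI ~ - PI] both [U] and [G] are differentiable while the penalty
   [- delta x^2] has a convex kink, so the error has no maximum there. *)
Lemma no_large_maximum_boundary G Gt Gx Gxx q C delta eps a b :
  periodic_heat_solution G Gt Gx Gxx -> a = PI \/ a = - PI -> 0 <= b -> tame q C ->
  0 < delta -> no_large_maximum G q delta eps a b.
Proof.
  intros hG ha hb hq hdelta. pose proof PI_RGT_0 as hpi.
  pose proof (tame_nonneg q C hq) as hC.
  destruct (phs_space _ _ _ _ hG b hb) as [qb [Cb [hqb eqb]]].
  pose proof (tame_nonneg qb Cb hqb) as hCb.
  (* The maximum is compared with the values at [PI - h] and [- PI + h], where the kink gains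
     [4 * delta * PI * h] in total. Second differences lose at most [K * h ^ 2]; [h] is chosen so
     that this is at most half of the gain. *)
  set (K := C + Cb + 2 * delta).
  assert (hK : 0 < K) by (unfold K; lra).
  set (h := Rmin PI (2 * delta * PI / K)).
  assert (hh : 0 < h).
  { apply Rmin_pos; [lra|]. apply Rdiv_lt_0_compat; nra. }
  assert (h1 : h <= PI) by apply Rmin_l.
  assert (h2 : K * h <= 2 * delta * PI).
  { assert (h <= 2 * delta * PI / K) by apply Rmin_r.
    apply Rle_div_r in H; [lra | exact hK]. }
  assert (hg : 0 < delta * PI * h / 4).
  { assert (0 < delta * PI) by (apply Rmult_lt_0_compat; lra).
    assert (0 < delta * PI * h) by (apply Rmult_lt_0_compat; lra). lra. }
  assert (ha' : - PI <= a <= PI) by (destruct ha; lra).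
  (* Continuity at three points of the slice [b] transfers its constant [Cb] to the time [t] of the
     maximum, whose own slice has no known constant. These errors use up a quarter of the gain. *)
  destruct (phs_cont _ _ _ _ hG a b ltac:(split; simpl; lra) _ hg) as [r1 [hr1 c1]].
  destruct (phs_cont _ _ _ _ hG (PI - h) b ltac:(split; simpl; lra) _ hg) as [r2 [hr2 c2]].
  destruct (phs_cont _ _ _ _ hG (- PI + h) b ltac:(split; simpl; lra) _ hg) as [r3 [hr3 c3]].
  (* [L * d] bounds the cost of moving from [x] to [a], in [U] and in the quadratic penalty; [d]
     keeps it to an eighth of the gain. *)
  set (L := 2 * C + 4 * PI * delta).
  assert (hL : 0 < L) by (unfold L; nra).
  set (d := Rmin (Rmin r1 r2) (Rmin r3 (delta * PI * h / (2 * L)))).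
  assert (hd : 0 < d).
  { repeat apply Rmin_pos; try assumption. apply Rdiv_lt_0_compat; lra. }
  assert (hd1 : d <= r1) by (unfold d; eapply Rle_trans; [apply Rmin_l | apply Rmin_l]).
  assert (hd2 : d <= r2) by (unfold d; eapply Rle_trans; [apply Rmin_l | apply Rmin_r]).
  assert (hd3 : d <= r3) by (unfold d; eapply Rle_trans; [apply Rmin_r | apply Rmin_l]).
  assert (hd4 : L * d <= delta * PI * h / 2).
  { assert (hd4 : d <= delta * PI * h / (2 * L))
      by (unfold d; eapply Rle_trans; [apply Rmin_r | apply Rmin_r]).
    apply Rle_div_r in hd4; lra. }
  exists d. split; [exact hd|].
  intros n m U J j x hn hm hl hU hU0 [hj [hx hmax]] hxa hjb. exfalso.
  destruct (inv_le_pos d _ hd hn) as [hn0 _].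
  destruct (inv_le_pos d _ hd hm) as [hm0 _].
  pose proof (mesh_ratio_pos n m hn0 hm0) as hl0.
  assert (htU : tame (U j) C).
  { apply (scheme_tame (mesh_ratio n m) (PI / INR n)); [lra | exact hU |].
    now apply (tame_ext _ q). }
  destruct htU as [u1 [u2 u3]]. destruct hqb as [b1 [_ b3]].
  pose proof (hmax j (PI - h) hj ltac:(lra)) as mp.
  pose proof (hmax j (- PI + h) hj ltac:(lra)) as mm.
  set (t := INR j / INR m) in *.
  assert (ht : 0 <= t) by (apply Rdiv_le_0_compat; [apply pos_INR | exact hm0]).
  pose proof (c1 x t ltac:(split; simpl; lra) ltac:(lra) ltac:(lra)) as k1.
  assert (z0 : forall y, Rabs (y - y) = 0).
  { intros y. unfold Rminus. rewrite Rplus_opp_r. apply Rabs_R0. }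
  pose proof (c2 (PI - h) t ltac:(split; simpl; lra) ltac:(rewrite z0; lra) ltac:(lra)) as k2.
  pose proof (c3 (- PI + h) t ltac:(split; simpl; lra) ltac:(rewrite z0; lra) ltac:(lra)) as k3.
  pose proof (u3 PI h) as w1. pose proof (b3 PI h) as w2.
  unfold second_difference in w1, w2.
  rewrite (eqb a), (eqb (PI - h)), (eqb (- PI + h)) in * by lra.
  (* Periodicity folds the second differences at [PI] back into the interval and treats both
     endpoints alike. *)
  assert (e1 : U j (PI + h) = U j (- PI + h)).
  { rewrite <- (u1 (- PI + h)). f_equal. ring. }
  assert (e2 : qb (PI + h) = qb (- PI + h)).
  { rewrite <- (b1 (- PI + h)). f_equal. ring. }
  assert (e3 : U j a = U j PI).
  { destruct ha as [->| ->]; [reflexivity|]. rewrite <- (u1 (- PI)). f_equal. ring. }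
  assert (e4 : qb a = qb PI).
  { destruct ha as [->| ->]; [reflexivity|]. rewrite <- (b1 (- PI)). f_equal. ring. }
  pose proof (u2 a (x - a)) as w3. replace (a + (x - a)) with x in w3 by ring.
  assert (w4 : Rabs (U j x - U j a) <= C * d) by nra.
  assert (hx2 : PI ^ 2 - 2 * PI * d <= x ^ 2).
  { apply Rabs_lt_between in hxa. destruct ha; subst a; nra. }
  rewrite e1 in w1. rewrite e2 in w2. rewrite e3 in w4. rewrite e4 in k1.
  apply Rabs_lt_between in k1, k2, k3. apply Rabs_le_between in w1, w2, w4.
  unfold penalized_error in mp, mm. fold t in mp, mm.
  assert (hx3 : delta * (PI ^ 2 - 2 * PI * d) <= delta * x ^ 2).
  { apply Rmult_le_compat_l; lra. }
  assert (hKh : K * h * h <= 2 * delta * PI * h).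
  { apply Rmult_le_compat_r; lra. }
  unfold K in hKh. unfold L in hd4.
  nra.
Qed.

(** * From local statements to uniform convergence of the scheme *)

Lemma lipschitz_continuous (f : R -> R) (C : R) :
  (forall x k, Rabs (f (x + k) - f x) <= C * Rabs k) -> forall x, continuity_pt f x.
Proof.
  intros h x eps heps.
  assert (hC : 0 <= C).
  { specialize (h 0 1). rewrite (Rabs_pos_eq 1) in h by lra.
    pose proof (Rabs_pos (f (0 + 1) - f 0)). lra. }
  exists (eps / (C + 1)). split; [apply Rdiv_lt_0_compat; lra|].
  intros y [_ hy]. simpl in *. unfold R_dist in *.
  specialize (h x (y - x)). replace (x + (y - x)) with y in h by ring.
  apply Rlt_div_r in hy; [|lra]. pose proof (Rabs_pos (y - x)). nra.
Qed.

Lemma no_large_maximum_everywhere G Gt Gx Gxx q C delta eps a b :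
  periodic_heat_solution G Gt Gx Gxx -> tame q C ->
  (forall x, - PI <= x <= PI -> G x 0 = q x) ->
  0 < delta -> 0 < eps -> T_dom (a, b) -> no_large_maximum G q delta eps a b.
Proof.
  intros hG hq hq0 hdelta heps hab. pose proof hab as [ha hb]; simpl in ha, hb.
  destruct (Req_dec b 0) as [->|hb0].
  { apply (no_large_maximum_initial G q C); auto. now apply (phs_cont _ _ _ _ hG). }
  destruct (Req_dec a PI) as [ea|ea].
  { apply (no_large_maximum_boundary G Gt Gx Gxx q C); auto. }
  destruct (Req_dec a (- PI)) as [ea'|ea'].
  { apply (no_large_maximum_boundary G Gt Gx Gxx q C); auto. }
  apply (no_large_maximum_interior G Gt Gx Gxx); auto. split; simpl; lra.
Qed.

Lemma maximum_exists (v : nat -> R -> R) (J : nat) :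
  (forall j, exists x, - PI <= x <= PI /\ forall y, - PI <= y <= PI -> v j y <= v j x) ->
  exists j x, is_maximum v J j x.
Proof.
  intros hv. induction J as [|J [j [x [hj [hx hm]]]]].
  - destruct (hv O) as [x [hx hm]]. exists O, x. split; [lia | split; [exact hx|]].
    intros i y hi hy. replace i with O by lia. auto.
  - destruct (hv (S J)) as [x' [hx' hm']].
    destruct (Rle_dec (v (S J) x') (v j x)) as [hle|hle].
    + exists j, x. split; [lia | split; [exact hx|]]. intros i y hi hy.
      destruct (Nat.eq_dec i (S J)) as [->|hne].
      * eapply Rle_trans; [apply hm'; exact hy | exact hle].
      * apply hm; [lia | exact hy].
    + exists (S J), x'. split; [lia | split; [exact hx'|]]. intros i y hi hy.
      destruct (Nat.eq_dec i (S J)) as [->|hne]; [now apply hm'|].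
      eapply Rle_trans; [apply hm; [lia | exact hy] | lra].
Qed.

Lemma penalized_error_attains_max G Gt Gx Gxx C U delta m j :
  periodic_heat_solution G Gt Gx Gxx -> 0 < INR m -> tame (U j) C ->
  exists x, - PI <= x <= PI /\ forall y, - PI <= y <= PI ->
    penalized_error G U delta m j y <= penalized_error G U delta m j x.
Proof.
  intros hG hm hU. pose proof PI_RGT_0.
  assert (ht : 0 <= INR j / INR m) by (apply Rdiv_le_0_compat; [apply pos_INR | exact hm]).
  destruct (phs_space _ _ _ _ hG _ ht) as [p [D [hp ep]]].
  destruct (continuity_ab_maj
    (fun x => U j x - p x - 3 * delta * (INR j / INR m) - delta * x ^ 2) (- PI) PI)
    as [x [hmax hx]].
  - lra.
  - intros c _.
    apply (continuity_pt_minus (fun x => U j x - p x - 3 * delta * (INR j / INR m))).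
    + apply (continuity_pt_minus (fun x => U j x - p x)).
      * apply (continuity_pt_minus (U j) p).
        -- apply (lipschitz_continuous _ C), hU.
        -- apply (lipschitz_continuous _ D), hp.
      * apply continuity_pt_const. intros ? ?; reflexivity.
    + apply continuity_pt_filterlim, (ex_derive_continuous (fun x => delta * x ^ 2)).
      auto_derive; auto.
  - exists x. split; [exact hx|]. intros y hy. unfold penalized_error.
    rewrite (ep x hx), (ep y hy). now apply hmax.
Qed.

(** Compactness of [[- PI, PI] x [0, tau]] gives one mesh threshold for all locations of the
    maximum. The penalized error is then at most [eps / 2] everywhere, and removing the penalty
    costs at most another [eps / 2]. *)
Lemma scheme_upper_bound G Gt Gx Gxx q C tau eps :
  periodic_heat_solution G Gt Gx Gxx -> tame q C ->
  (forall x, - PI <= x <= PI -> G x 0 = q x) ->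
  0 <= tau -> 0 < eps -> exists N, 0 < N /\ forall n m U,
    N <= INR n -> N <= INR m -> mesh_ratio n m <= 1 / 2 ->
    explicit_scheme (mesh_ratio n m) (PI / INR n) U ->
    (forall y, U O y = q y) ->
    forall j x, - PI <= x <= PI -> INR j / INR m <= tau ->
      U j x <= G x (INR j / INR m) + eps.
Proof.
  intros hG hq hq0 htau heps. pose proof PI_RGT_0 as hpi.
  assert (hW : 0 < 3 * tau + PI ^ 2) by nra.
  set (delta := eps / (2 * (3 * tau + PI ^ 2))).
  assert (hdelta : 0 < delta) by (apply Rdiv_lt_0_compat; lra).
  assert (edelta : delta * (3 * tau + PI ^ 2) = eps / 2) by (unfold delta; field; lra).
  set (good := fun a b (d : R) => forall n m U J j x,
    1 / d <= INR n -> 1 / d <= INR m -> mesh_ratio n m <= 1 / 2 ->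
    explicit_scheme (mesh_ratio n m) (PI / INR n) U ->
    (forall y, U O y = q y) ->
    is_maximum (penalized_error G U delta m) J j x ->
    Rabs (x - a) < d -> Rabs (INR j / INR m - b) < d ->
    penalized_error G U delta m j x <= eps / 2).
  (* The compactness theorem takes a gauge on the whole plane; off the domain the radius [1] is a
     dummy value. *)
  assert (hd : forall a b, exists d : posreal, T_dom (a, b) -> good a b d).
  { intros a b. destruct (classic (T_dom (a, b))) as [hab|hab].
    - destruct (no_large_maximum_everywhere G Gt Gx Gxx q C delta (eps / 2) a b)
        as [d [hd hd']]; auto; [lra|].
      exists (mkposreal d hd). intros _. exact hd'.
    - exists (mkposreal 1 Rlt_0_1). tauto. }
  set (dl := fun a b => proj1_sig (constructive_indefinite_description _ (hd a b))).
  assert (hdl : forall a b, T_dom (a, b) -> good a b (dl a b)).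
  { intros a b. exact (proj2_sig (constructive_indefinite_description _ (hd a b))). }
  destruct (compactness_value_2d (- PI) PI 0 tau dl) as [d hcomp].
  pose proof (cond_pos d) as hd0.
  exists (1 / d). split; [apply Rdiv_lt_0_compat; lra|].
  intros n m U hn hm hl hU hU0 j x hx hj.
  destruct (inv_le_pos d _ hd0 hn) as [hn0 _].
  destruct (inv_le_pos d _ hd0 hm) as [hm0 _].
  pose proof (mesh_ratio_pos n m hn0 hm0) as hl0.
  assert (htU : forall i, tame (U i) C).
  { intros i. apply (scheme_tame (mesh_ratio n m) (PI / INR n)); [lra | exact hU |].
    now apply (tame_ext _ q). }
  (* Only levels up to [j] compete, so the maximum occurs at a time at most [tau]. *)
  destruct (maximum_exists (penalized_error G U delta m) j) as [i [y hmax]].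
  { intros i. apply (penalized_error_attains_max G Gt Gx Gxx C); auto. }
  pose proof hmax as [hi [hy hmax']].
  assert (hti : INR i / INR m <= tau).
  { eapply Rle_trans; [|exact hj]. apply Rmult_le_compat_r.
    - left. now apply Rinv_0_lt_compat.
    - now apply le_INR. }
  assert (hti0 : 0 <= INR i / INR m) by (apply Rdiv_le_0_compat; [apply pos_INR | exact hm0]).
  assert (hb : penalized_error G U delta m i y <= eps / 2).
  (* The compactness theorem supplies the covering point only under a double negation, hence the
     argument by contradiction. *)
  { apply NNPP. intros hn'. apply (hcomp y (INR i / INR m) hy (conj hti0 hti)).
    intros [a [b [ha [hb [h1 [h2 h3]]]]]]. apply hn'.
    assert (hle : 1 / dl a b <= 1 / d).
    { unfold Rdiv. rewrite !Rmult_1_l. apply Rinv_le_contravar; assumption. }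
    apply (hdl a b ltac:(split; simpl; lra) n m U j i y); auto; lra. }
  pose proof (hmax' j x (Nat.le_refl j) hx) as hfin.
  unfold penalized_error in hfin at 1.
  assert (htj0 : 0 <= INR j / INR m) by (apply Rdiv_le_0_compat; [apply pos_INR | exact hm0]).
  assert (hx2 : delta * x ^ 2 <= delta * PI ^ 2) by (apply Rmult_le_compat_l; nra).
  assert (ht2 : delta * (INR j / INR m) <= delta * tau) by (apply Rmult_le_compat_l; lra).
  lra.
Qed.

(** The lower bound is the upper bound for [- U] and [- G], which satisfy the same hypotheses. *)
Lemma scheme_converges G Gt Gx Gxx q C tau eps :
  periodic_heat_solution G Gt Gx Gxx -> tame q C ->
  (forall x, - PI <= x <= PI -> G x 0 = q x) ->
  0 <= tau -> 0 < eps -> exists N, 0 < N /\ forall n m U,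
    N <= INR n -> N <= INR m -> mesh_ratio n m <= 1 / 2 ->
    explicit_scheme (mesh_ratio n m) (PI / INR n) U ->
    (forall y, U O y = q y) ->
    forall j x, - PI <= x <= PI -> INR j / INR m <= tau ->
      Rabs (U j x - G x (INR j / INR m)) <= eps.
Proof.
  intros hG hq hq0 htau heps.
  destruct (scheme_upper_bound G Gt Gx Gxx q C tau eps) as [N1 [hN1 h1]]; auto.
  destruct (scheme_upper_bound (fun x t => - G x t) (fun x t => - Gt x t)
    (fun x t => - Gx x t) (fun x t => - Gxx x t) (fun x => - q x) C tau eps)
    as [N2 [hN2 h2]]; auto.
  { now apply periodic_heat_solution_opp. }
  { now apply tame_opp. }
  { intros x hx. now rewrite hq0. }
  exists (Rmax N1 N2). split; [eapply Rlt_le_trans; [exact hN1 | apply Rmax_l]|].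
  intros n m U hn hm hl hU hU0 j x hx hj.
  pose proof (Rmax_l N1 N2). pose proof (Rmax_r N1 N2).
  pose proof (h1 n m U ltac:(lra) ltac:(lra) hl hU hU0 j x hx hj) as k1.
  pose proof (h2 n m (fun j x => - U j x) ltac:(lra) ltac:(lra) hl
    (scheme_opp _ _ _ hU) ltac:(intros y; cbv beta; now rewrite hU0) j x hx hj) as k2.
  simpl in k2. apply Rabs_le_between. lra.
Qed.

(** * Grid functions *)

Definition is_component (l : C -> R) : Prop := l = Re \/ l = Im.

Lemma component_scal (l : C -> R) :
  is_component l -> forall r z w, l (RtoC r * (z - w))%C = r * (l z - l w).
Proof. intros [->| ->] r [z1 z2] [w1 w2]; simpl; ring. Qed.

Lemma component_derive (l : C -> R) :
  is_component l -> forall f x c, is_derive_C f x c -> is_derive (fun y => l (f y)) x (l c).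
Proof.
  intros hl f x c hf.
  assert (hlin : @is_linear R_AbsRing C_R_NormedModule R_NormedModule l).
  { destruct hl as [->| ->]; [apply is_linear_fst | apply is_linear_snd]. }
  unfold is_derive_C, is_derive in *.
  eapply filterdiff_ext_lin.
  - apply (filterdiff_comp f l _ l hf). apply filterdiff_linear, hlin.
  - intros y. apply (@linear_scal R_AbsRing C_R_NormedModule R_NormedModule l hlin).
Qed.

Lemma component_continuous (l : C -> R) :
  is_component l -> forall z : C, @continuous C_UniformSpace R_UniformSpace l z.
Proof.
  intros [->| ->] z; [apply (continuous_fst (fst z) (snd z)) | apply (continuous_snd (fst z) (snd z))].
Qed.

Lemma continuous_on_within (D : R * R -> Prop) (f : R * R -> C) (l : C -> R) (a b : R) :
  is_component l ->
  @continuous_on (prod_UniformSpace R_UniformSpace R_UniformSpace) C_UniformSpace D f ->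
  D (a, b) ->
  continuous_at_within D (fun x t => l (f (x, t))) a b.
Proof.
  intros hl hf hab eps heps.
  pose proof (filterlim_comp _ _ _ f l _ _ _ (hf _ hab) (component_continuous l hl _)) as h.
  destruct (h _ (locally_ball (l (f (a, b))) (mkposreal eps heps))) as [r hr].
  exists r. split; [apply cond_pos|].
  intros x t hd hx ht. apply (hr (x, t)); [split; assumption | exact hd].
Qed.

(** The angular form [u (cos x, sin x)] is the periodic extension of [g] to the line. *)
Lemma Cinf_circle_tame (g : R -> C) (l : C -> R) :
  is_component l -> Cinf_circle g ->
  exists q K, tame q K /\ forall x, - PI <= x <= PI -> l (g x) = q x.
Proof.
  intros hl [u [hu eu]].
  destruct (hu 2%nat) as [_ [f' [h1 [_ [f'' [h2 [h3 _]]]]]]].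
  destruct (tame_of_derivatives (fun x => l (u (cos x, sin x)))
    (fun x => l (f' x)) (fun x => l (f'' x))) as [K hK].
  - intros x. now rewrite cos_plus, sin_plus, cos_2PI, sin_2PI, !Rmult_1_r, !Rmult_0_r,
      Rminus_0_r, Rplus_0_r.
  - intros x. apply (component_derive l hl (fun th => u (cos th, sin th))). apply h1.
  - intros x. apply (component_derive l hl). apply h2.
  - intros x. apply (continuous_comp f'' l); [apply h3 | now apply component_continuous].
  - exists (fun x => l (u (cos x, sin x))), K. split; [exact hK|].
    intros x hx. now rewrite eu.
Qed.

(** The derivatives in [heat_equation] come without continuity, those in [smooth_plane] without the
    equation. Uniqueness of derivatives identifies them; for [Gxx] the first derivatives must agree
    on a neighbourhood of [x]. *)
Lemma classical_solution_component (g : R -> C) (G : R * R -> C) (l : C -> R) :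
  is_component l -> classical_solution g G ->
  exists Gt Gx Gxx, periodic_heat_solution (fun x t => l (G (x, t))) Gt Gx Gxx.
Proof.
  intros hl [[hc [hs hsm]] [[Hx [Hxx [Ht heq]]] _]].
  destruct (hsm 2%nat) as [_ [fx [ft [hd [[_ [fxx [fxt [hdx [[hcxx _] _]]]]] [hct _]]]]]].
  exists (fun x t => l (ft (x, t))), (fun x t => l (fx (x, t))), (fun x t => l (fxx (x, t))).
  split.
  - intros a b hab. now apply (continuous_on_within T_dom G).
  - intros t ht. apply (Cinf_circle_tame (fun x => G (x, t))); auto.
  - intros x t hxt. apply (component_derive l hl (fun s => G (x, s))), hd, hxt.
  - intros x t hxt. apply (component_derive l hl (fun y => G (y, t))), hd, hxt.
  - intros x t hxt. apply (component_derive l hl (fun y => fx (y, t))), hdx, hxt.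
  - intros x t hxt.
    destruct (heq x t hxt) as [_ [e2 [e3 e4]]].
    apply (component_derive l hl) in e2, e3.
    pose proof (proj2 (hd x t hxt)) as d3. apply (component_derive l hl) in d3.
    pose proof (proj1 (hdx x t hxt)) as d2. apply (component_derive l hl) in d2.
    apply is_derive_unique in e3, d3. cbv beta in e3, d3. rewrite <- d3, e3, e4.
    rewrite <- (is_derive_unique _ _ _ e2), <- (is_derive_unique _ _ _ d2).
    apply Derive_ext_loc.
    destruct hxt as [hx ht]; simpl in hx, ht.
    assert (hr : 0 < Rmin (PI - x) (x + PI)) by (apply Rmin_pos; lra).
    exists (mkposreal _ hr). intros y hy.
    change (Rabs (y - x) < Rmin (PI - x) (x + PI)) in hy.
    apply Rabs_lt_between in hy.
    pose proof (Rmin_l (PI - x) (x + PI)). pose proof (Rmin_r (PI - x) (x + PI)).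
    assert (hyt : T0_dom (y, t)) by (split; simpl; lra).
    pose proof (proj1 (heq y t hyt)) as a1. pose proof (proj1 (hd y t hyt)) as a2.
    apply (component_derive l hl) in a1, a2.
    now rewrite <- (is_derive_unique _ _ _ a1), <- (is_derive_unique _ _ _ a2).
  - intros a b hab. now apply (continuous_on_within T0_dom ft).
  - intros a b hab. now apply (continuous_on_within T0_dom fxx).
Qed.

(** * The difference equations on the periodic grid *)

Definition next_index (n i : nat) : nat := if Nat.eqb i (2 * n - 1) then O else (i + 1)%nat.
Definition prev_index (n i : nat) : nat := if Nat.eqb i 0 then (2 * n - 1)%nat else (i - 1)%nat.

Definition x_index (n : nat) (x : R) : nat := Z.to_nat (Int_part (INR n * (x + PI) / PI)).
Definition t_index (m : nat) (t : R) : nat := Z.to_nat (Int_part (INR m * t)).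

Definition central_quotient (n : nat) (a b : C) : C := (RtoC (INR n / (2 * PI)) * (a - b))%C.
Definition forward_quotient (m : nat) (a b : C) : C := (RtoC (INR m) * (a - b))%C.

(** The standard counterpart of the internal problem, at the nodes only. The nested quotients are
    left as two successive discrete derivatives produce them. *)
Definition grid_solution (g : R -> C) (n m : nat) (phi : R * R -> C) : Prop :=
  (forall i, (i <= 2 * n - 1)%nat -> phi (x_node n i, 0) = g (x_node n i)) /\
  (forall i j, (i <= 2 * n - 1)%nat -> (j <= m ^ 2 - 2)%nat ->
     forward_quotient m (phi (x_node n i, t_node m (j + 1))) (phi (x_node n i, t_node m j)) =
     central_quotient n
       (central_quotient n
          (phi (x_node n (next_index n (next_index n i)), t_node m j))
          (phi (x_node n (prev_index n (next_index n i)), t_node m j)))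
       (central_quotient n
          (phi (x_node n (next_index n (prev_index n i)), t_node m j))
          (phi (x_node n (prev_index n (prev_index n i)), t_node m j)))).

Lemma next_prev_index (n i : nat) :
  (1 <= n)%nat -> (i <= 2 * n - 1)%nat ->
  (next_index n i <= 2 * n - 1)%nat /\ (prev_index n i <= 2 * n - 1)%nat /\
  prev_index n (next_index n i) = i /\ next_index n (prev_index n i) = i.
Proof.
  intros hn hi. unfold next_index, prev_index.
  destruct (Nat.eqb_spec i (2 * n - 1)), (Nat.eqb_spec i 0);
    repeat match goal with
    | |- context [Nat.eqb ?a ?b] => destruct (Nat.eqb_spec a b)
    end; lia.
Qed.

Lemma next_node (f : R -> R) (n i : nat) :
  (forall x, f (x + 2 * PI) = f x) -> (1 <= n)%nat ->
  f (x_node n (next_index n i)) = f (x_node n i + PI / INR n).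
Proof.
  intros hf hn. assert (hn0 : 0 < INR n) by (apply lt_0_INR; lia).
  unfold next_index. destruct (Nat.eqb_spec i (2 * n - 1)) as [->|hi].
  - rewrite <- hf. unfold x_node. f_equal. rewrite minus_INR, mult_INR by lia.
    simpl. field. lra.
  - unfold x_node. rewrite plus_INR. f_equal. simpl. field. lra.
Qed.

Lemma prev_node (f : R -> R) (n i : nat) :
  (forall x, f (x + 2 * PI) = f x) -> (1 <= n)%nat ->
  f (x_node n (prev_index n i)) = f (x_node n i - PI / INR n).
Proof.
  intros hf hn. assert (hn0 : 0 < INR n) by (apply lt_0_INR; lia).
  unfold prev_index. destruct (Nat.eqb_spec i 0) as [->|hi].
  - rewrite <- (hf (x_node n 0 - PI / INR n)). unfold x_node. f_equal. rewrite minus_INR, mult_INR by lia.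
    simpl. field. lra.
  - unfold x_node. rewrite minus_INR by lia. f_equal. simpl. field. lra.
Qed.

Fixpoint scheme_solution (lam h : R) (q : R -> R) (j : nat) : R -> R :=
  match j with
  | O => q
  | S j' => fun x => scheme_solution lam h q j' x
                     + lam * second_difference (scheme_solution lam h q j') x (2 * h)
  end.

Lemma x_node_range (n i : nat) :
  (1 <= n)%nat -> (i <= 2 * n - 1)%nat -> - PI <= x_node n i < PI.
Proof.
  intros hn hi. assert (hn0 : 0 < INR n) by (apply lt_0_INR; lia).
  pose proof PI_RGT_0. unfold x_node.
  assert (h1 : 0 <= INR i / INR n) by (apply Rdiv_le_0_compat; [apply pos_INR | exact hn0]).
  assert (h2 : INR i / INR n < 2).
  { apply Rlt_div_l; [exact hn0|]. replace (2 * INR n) with (INR (2 * n)) by (rewrite mult_INR; reflexivity).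
    apply lt_INR. lia. }
  nra.
Qed.

(** Induction on the time level: [l] commutes with the quotients, and neighbours at cyclic distance
    two are translates by [2 * (PI / INR n)] up to a period, so the grid equation solved for level
    [j + 1] is the scheme. *)
Lemma grid_solution_component (l : C -> R) (g : R -> C) (q : R -> R) (n m : nat)
    (phi : R * R -> C) :
  is_component l -> (1 <= n)%nat -> (2 <= m)%nat ->
  (forall x, q (x + 2 * PI) = q x) ->
  (forall x, - PI <= x <= PI -> l (g x) = q x) ->
  grid_solution g n m phi ->
  forall j i, (j <= m ^ 2 - 1)%nat -> (i <= 2 * n - 1)%nat ->
    l (phi (x_node n i, t_node m j)) =
    scheme_solution (mesh_ratio n m) (PI / INR n) q j (x_node n i).
Proof.
  intros hl hn hm hq hgq [hphi0 hphi].
  assert (hn0 : 0 < INR n) by (apply lt_0_INR; lia).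
  assert (hm0 : 0 < INR m) by (apply lt_0_INR; lia).
  pose proof PI_RGT_0 as hpi.
  induction j as [|j IH]; intros i hj hi.
  - simpl. replace (t_node m 0) with 0 by (unfold t_node; simpl; field; lra).
    rewrite hphi0 by exact hi. apply hgq. pose proof (x_node_range n i hn hi). lra.
  - destruct (next_prev_index n i hn hi) as [a1 [a2 [a3 a4]]].
    destruct (next_prev_index n _ hn a1) as [b1 _].
    destruct (next_prev_index n _ hn a2) as [_ [b2 _]].
    assert (hm4 : (4 <= m ^ 2)%nat) by (simpl; nia).
    pose proof (hphi i j hi ltac:(lia)) as e.
    rewrite a3, a4 in e. apply (f_equal l) in e.
    unfold forward_quotient, central_quotient in e.
    rewrite !(component_scal l hl) in e.
    replace (j + 1)%nat with (S j) in e by lia.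
    rewrite (IH _ ltac:(lia) b1), (IH _ ltac:(lia) b2), (IH _ ltac:(lia) hi) in e.
    set (U := scheme_solution (mesh_ratio n m) (PI / INR n) q) in *.
    assert (hper : forall x, U j (x + 2 * PI) = U j x).
    { apply (scheme_periodic (mesh_ratio n m) (PI / INR n) U); [|exact hq].
      intros k x; reflexivity. }
    rewrite (next_node (U j)), (prev_node (U j)) in e by assumption.
    rewrite (next_node (fun x => U j (x + PI / INR n))) in e.
    2: { intros x. rewrite <- (hper (x + PI / INR n)). f_equal. ring. }
    2: exact hn.
    rewrite (prev_node (fun x => U j (x - PI / INR n))) in e.
    2: { intros x. rewrite <- (hper (x - PI / INR n)). f_equal. ring. }
    2: exact hn.
    change (U (S j) (x_node n i)) with
      (U j (x_node n i) + mesh_ratio n m * second_difference (U j) (x_node n i) (2 * (PI / INR n))).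
    unfold second_difference.
    replace (x_node n i + 2 * (PI / INR n)) with (x_node n i + PI / INR n + PI / INR n) by ring.
    replace (x_node n i - 2 * (PI / INR n)) with (x_node n i - PI / INR n - PI / INR n) by ring.
    apply (Rmult_eq_reg_l (INR m)); [|lra].
    rewrite Rmult_plus_distr_l, <- Rmult_assoc.
    (* The mesh ratio is the squared factor of the centred quotient divided by that of the time
       quotient. *)
    replace (INR m * mesh_ratio n m) with (INR n / (2 * PI) * (INR n / (2 * PI)))
      by (unfold mesh_ratio; field; lra).
    lra.
Qed.

Lemma Int_part_to_nat (r : R) :
  0 <= r -> INR (Z.to_nat (Int_part r)) <= r < INR (Z.to_nat (Int_part r)) + 1.
Proof.
  intros hr. destruct (base_Int_part r) as [h1 h2].
  assert (h0 : (0 <= Int_part r)%Z).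
  { apply Z.lt_pred_le. apply lt_IZR. unfold Z.pred. rewrite plus_IZR. simpl. lra. }
  rewrite INR_IZR_INZ, Z2Nat.id by exact h0. lra.
Qed.

Lemma x_index_spec (n : nat) (x : R) :
  (1 <= n)%nat -> - PI <= x < PI ->
  (x_index n x <= 2 * n - 1)%nat /\
  x_node n (x_index n x) <= x < x_node n (x_index n x + 1).
Proof.
  intros hn hx. assert (hn0 : 0 < INR n) by (apply lt_0_INR; lia).
  pose proof PI_RGT_0 as hpi.
  destruct (Int_part_to_nat (INR n * (x + PI) / PI)) as [h1 h2].
  { apply Rdiv_le_0_compat; [nra | lra]. }
  fold (x_index n x) in h1, h2. split.
  - assert (hlt : (x_index n x < 2 * n)%nat); [|lia].
    apply INR_lt. rewrite mult_INR. eapply Rle_lt_trans; [exact h1|].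
    apply Rlt_div_l; [exact hpi|]. simpl. nra.
  - unfold x_node. rewrite plus_INR. simpl (INR 1).
    apply Rle_div_r in h1; [|exact hpi]. apply Rlt_div_l in h2; [|exact hpi].
    assert (k1 : INR (x_index n x) / INR n <= (x + PI) / PI).
    { apply Rle_div_l; [exact hn0|].
      apply Rmult_le_reg_r with PI; [exact hpi|].
      replace ((x + PI) / PI * INR n * PI) with (INR n * (x + PI)) by (field; lra). lra. }
    assert (k2 : (x + PI) / PI < (INR (x_index n x) + 1) / INR n).
    { apply (Rlt_div_r ((x + PI) / PI)); [exact hn0|].
      apply Rmult_lt_reg_r with PI; [exact hpi|].
      replace ((x + PI) / PI * INR n * PI) with (INR n * (x + PI)) by (field; lra). lra. }
    assert (ex : PI * ((x + PI) / PI) = x + PI) by (field; lra).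
    split; nra.
Qed.

Lemma t_index_spec (m : nat) (t : R) :
  (1 <= m)%nat -> 0 <= t < INR m ->
  (t_index m t <= m ^ 2 - 1)%nat /\
  t_node m (t_index m t) <= t < t_node m (t_index m t + 1).
Proof.
  intros hm ht. assert (hm0 : 0 < INR m) by (apply lt_0_INR; lia).
  destruct (Int_part_to_nat (INR m * t)) as [h1 h2]; [nra|].
  fold (t_index m t) in h1, h2. split.
  - assert (hlt : (t_index m t < m ^ 2)%nat); [|lia].
    apply INR_lt. rewrite pow_INR. simpl. nra.
  - unfold t_node. rewrite plus_INR. simpl (INR 1).
    split; [apply Rle_div_l | apply Rlt_div_r]; lra.
Qed.

(** The node of the cell of [(x, t)] lies within one mesh width of it. Convergence of the scheme up
    to time [b + r] and continuity of [G] at [(a, b)] each contribute [eps / 2]. *)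
Lemma grid_solution_component_converges (g : R -> C) (G : R * R -> C) (l : C -> R)
    (a b eps : R) :
  is_component l -> Cinf_circle g -> classical_solution g G -> T_dom (a, b) -> 0 < eps ->
  exists N r, 0 < r /\ forall n m phi x t,
    N <= INR n -> N <= INR m -> INR n <= PI * sqrt (2 * INR m) ->
    grid_solution g n m phi ->
    - PI <= x < PI -> 0 <= t < INR m -> Rabs (x - a) < r -> Rabs (t - b) < r ->
    Rabs (l (phi (x_node n (x_index n x), t_node m (t_index m t))) - l (G (a, b))) < eps.
Proof.
  intros hl hg hG hab heps. pose proof PI_RGT_0 as hpi. pose proof PI_4 as hpi4.
  destruct (classical_solution_component g G l hl hG) as [Gt [Gx [Gxx hsol]]].
  destruct (Cinf_circle_tame g l hl hg) as [q [K [hq egq]]].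
  destruct (phs_cont _ _ _ _ hsol a b hab (eps / 2)) as [r [hr hcont]]; [lra|].
  pose proof hab as [ha hb]; simpl in ha, hb.
  destruct (scheme_converges _ Gt Gx Gxx q K (b + r) (eps / 2) hsol hq) as [N [hN hconv]].
  { intros x hx. rewrite <- egq by exact hx. f_equal. now apply hG. }
  { lra. }
  { lra. }
  (* [8 / r] makes both mesh widths at most [r / 2], by [PI <= 4]; the [2] keeps the truncated
     subtraction in [m ^ 2 - 2] harmless. *)
  exists (Rmax (Rmax N 2) (8 / r)), (r / 2). split; [lra|].
  intros n m phi x t hn hm hcfl hphi hx ht hxa htb.
  pose proof (Rmax_l (Rmax N 2) (8 / r)). pose proof (Rmax_r (Rmax N 2) (8 / r)).
  pose proof (Rmax_l N 2). pose proof (Rmax_r N 2).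
  assert (hn2 : (2 <= n)%nat) by (apply INR_le; simpl (INR 2); lra).
  assert (hm2 : (2 <= m)%nat) by (apply INR_le; simpl (INR 2); lra).
  destruct (x_index_spec n x ltac:(lia) hx) as [i1 i2].
  destruct (t_index_spec m t ltac:(lia) ht) as [j1 j2].
  assert (hn0 : 0 < INR n) by lra. assert (hm0 : 0 < INR m) by lra.
  assert (sx : PI / INR n <= r / 2).
  { apply Rle_div_l; [exact hn0|].
    assert (8 / r <= INR n) by lra. apply Rle_div_l in H3; [|exact hr]. lra. }
  assert (st : 1 / INR m <= r / 2).
  { apply Rle_div_l; [exact hm0|].
    assert (8 / r <= INR m) by lra. apply Rle_div_l in H3; [|exact hr]. lra. }
  set (i := x_index n x) in *. set (j := t_index m t) in *.
  assert (ex : x_node n (i + 1) = x_node n i + PI / INR n).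
  { unfold x_node. rewrite plus_INR. simpl. field. lra. }
  assert (et : t_node m (j + 1) = t_node m j + 1 / INR m).
  { unfold t_node. rewrite plus_INR. simpl. field. lra. }
  rewrite ex in i2. rewrite et in j2.
  pose proof (x_node_range n i ltac:(lia) i1) as hxi'.
  assert (hxi : - PI <= x_node n i <= PI) by lra.
  assert (htj : 0 <= t_node m j) by (apply Rdiv_le_0_compat; [apply pos_INR | exact hm0]).
  apply Rabs_lt_between in hxa, htb.
  rewrite (grid_solution_component l g q n m phi) by (auto; try lia; apply hq).
  pose proof (hcont (x_node n i) (t_node m j) ltac:(split; simpl; lra)
    ltac:(apply Rabs_lt_between; lra) ltac:(apply Rabs_lt_between; lra)) as c1.
  pose proof (hconv n m (scheme_solution (mesh_ratio n m) (PI / INR n) q)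
    ltac:(lra) ltac:(lra) (mesh_ratio_cfl n m hm0 hcfl) ltac:(intros k y; reflexivity)
    ltac:(reflexivity) j (x_node n i) hxi) as c2.
  fold (t_node m j) in c2. specialize (c2 ltac:(lra)).
  cbv beta in c1, c2. apply Rabs_lt_between in c1. apply Rabs_le_between in c2.
  apply Rabs_lt_between. lra.
Qed.

Lemma grid_solution_converges (g : R -> C) (G : R * R -> C) (a b eps : R) :
  Cinf_circle g -> classical_solution g G -> T_dom (a, b) -> 0 < eps ->
  exists (N : nat) r, 0 < r /\ forall n m phi x t,
    (N <= n)%nat -> (N <= m)%nat -> INR n <= PI * sqrt (2 * INR m) ->
    grid_solution g n m phi ->
    - PI <= x < PI -> 0 <= t < INR m -> Rabs (x - a) < r -> Rabs (t - b) < r ->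
    Cmod (phi (x_node n (x_index n x), t_node m (t_index m t)) - G (a, b))%C < eps.
Proof.
  intros hg hG hab heps.
  destruct (grid_solution_component_converges g G Re a b (eps / 2)) as [N1 [r1 [hr1 h1]]];
    auto; [now left | lra |].
  destruct (grid_solution_component_converges g G Im a b (eps / 2)) as [N2 [r2 [hr2 h2]]];
    auto; [now right | lra |].
  destruct (INR_unbounded (Rmax N1 N2)) as [N hN].
  pose proof (Rmax_l N1 N2). pose proof (Rmax_r N1 N2).
  exists N, (Rmin r1 r2). split; [now apply Rmin_pos|].
  intros n m phi x t hn hm hcfl hphi hx ht hxa htb.
  pose proof (Rmin_l r1 r2). pose proof (Rmin_r r1 r2).
  apply le_INR in hn, hm.
  pose proof (h1 n m phi x t ltac:(lra) ltac:(lra) hcfl hphi hx ht ltac:(lra) ltac:(lra)) as k1.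
  pose proof (h2 n m phi x t ltac:(lra) ltac:(lra) hcfl hphi hx ht ltac:(lra) ltac:(lra)) as k2.
  destruct (phi _) as [z1 z2], (G (a, b)) as [w1 w2]. simpl in k1, k2.
  eapply Rle_lt_trans; [apply Cmod_2Rmax|]. simpl.
  change (z1 + - w1) with (z1 - w1). change (z2 + - w2) with (z2 - w2).
  set (M := Rmax _ _).
  assert (hM : M < eps / 2) by (apply Rmax_lub_lt; assumption).
  assert (hM0 : 0 <= M) by (eapply Rle_trans; [apply Rabs_pos | apply Rmax_l]).
  assert (hs : sqrt 2 <= 2).
  { rewrite <- (sqrt_Rsqr 2) at 2 by lra. apply sqrt_le_1_alt. unfold Rsqr. lra. }
  nra.
Qed.

(** * Transfer *)

Lemma lift_lift (E : nonstandard_extension) A B D (f : A -> B) (g : B -> D) (c : star E A) :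
  lift E g (lift E f c) = lift E (fun x => g (f x)) c.
Proof. symmetry. apply lift_comp. Qed.

Lemma tup_lift (E : nonstandard_extension) A B D (f : A -> B) (g : A -> D) (c : star E A) :
  tup E (lift E f c) (lift E g c) = lift E (fun x => (f x, g x)) c.
Proof. rewrite <- (tup_surj (lift E (fun x => (f x, g x)) c)). now rewrite !lift_lift. Qed.

(** An everywhere true predicate equals, by extensionality, the negation of a contradiction, to
    which the clauses for negation and conjunction apply. *)
Lemma holds_of_forall (E : nonstandard_extension) A (P : A -> Prop) (c : star E A) :
  (forall x, P x) -> holds E P c.
Proof.
  intros hP.
  assert (h : holds E (fun x => ~ (P x /\ ~ P x)) c).
  { apply holds_not. rewrite holds_and, holds_not. tauto. }
  replace P with (fun x => ~ (P x /\ ~ P x)); [exact h|].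
  apply functional_extensionality. intros x. apply propositional_extensionality.
  specialize (hP x). tauto.
Qed.

Lemma holds_impl (E : nonstandard_extension) A (P Q : A -> Prop) (c : star E A) :
  holds E (fun x => P x -> Q x) c <-> (holds E P c -> holds E Q c).
Proof.
  replace (fun x => P x -> Q x) with (fun x => ~ (P x /\ ~ Q x)).
  - rewrite holds_not, holds_and, holds_not. tauto.
  - apply functional_extensionality. intros x. apply propositional_extensionality. tauto.
Qed.

Lemma holds_mono (E : nonstandard_extension) A (P Q : A -> Prop) (c : star E A) :
  (forall x, P x -> Q x) -> holds E P c -> holds E Q c.
Proof. intros h. apply holds_impl. now apply holds_of_forall. Qed.

Lemma holds_incompatible (E : nonstandard_extension) A (P Q : A -> Prop) (c : star E A) :
  (forall x, P x -> Q x -> False) -> holds E P c -> holds E Q c -> False.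
Proof.
  intros h hP. apply holds_not. revert hP. apply holds_mono. exact h.
Qed.

Lemma holds_forall (E : nonstandard_extension) A B (P : A -> B -> Prop) (c : star E A) :
  (forall b, holds E (fun p => P (fst p) (snd p)) (tup E c b)) ->
  holds E (fun x => forall y, P x y) c.
Proof.
  intros h. apply NNPP. intros hn.
  apply holds_not in hn.
  apply (holds_mono E A _ (fun x => exists y, (fun p => ~ P (fst p) (snd p)) (x, y))) in hn.
  - apply (holds_exists (fun p => ~ P (fst p) (snd p))) in hn. destruct hn as [b hb]. apply holds_not in hb. auto.
  - intros x hx. apply not_all_ex_not in hx. exact hx.
Qed.

Lemma lift_eq (E : nonstandard_extension) A B (f g : A -> B) (c : star E A) :
  holds E (fun x => f x = g x) c <-> lift E f c = lift E g c.
Proof. rewrite <- holds_eq, tup_lift, holds_lift. reflexivity. Qed.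

(* A constant map factors through [unit], and [star unit] has one element by [holds_eq]. *)
Lemma lift_const (E : nonstandard_extension) A B (b : B) (c : star E A) :
  lift E (fun _ => b) c = std E b.
Proof.
  assert (e : lift E (fun _ => tt) c = std E tt).
  { apply holds_eq, holds_of_forall. now intros [[] []]. }
  rewrite <- (lift_std E (fun _ : unit => b) tt), <- e. now rewrite lift_lift.
Qed.

(** Once all parameters are coordinates of one element [c], nested extensions collapse into a single
    [lift], and an internal statement becomes one predicate at [c]. *)
Lemma lift2_lift (E : nonstandard_extension) D A1 A2 B (f : A1 -> A2 -> B)
    (p1 : D -> A1) (p2 : D -> A2) (c : star E D) :
  lift2 f (lift E p1 c) (lift E p2 c) = lift E (fun d => f (p1 d) (p2 d)) c.
Proof. unfold lift2. now rewrite tup_lift, lift_lift. Qed.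

Lemma lift3_lift (E : nonstandard_extension) D A1 A2 A3 B (f : A1 -> A2 -> A3 -> B)
    (p1 : D -> A1) (p2 : D -> A2) (p3 : D -> A3) (c : star E D) :
  lift3 f (lift E p1 c) (lift E p2 c) (lift E p3 c) =
  lift E (fun d => f (p1 d) (p2 d) (p3 d)) c.
Proof. unfold lift3. now rewrite tup_lift, lift2_lift. Qed.

Lemma holds2_lift (E : nonstandard_extension) D A1 A2 (P : A1 -> A2 -> Prop)
    (p1 : D -> A1) (p2 : D -> A2) (c : star E D) :
  holds2 P (lift E p1 c) (lift E p2 c) <-> holds E (fun d => P (p1 d) (p2 d)) c.
Proof. unfold holds2. now rewrite tup_lift, holds_lift. Qed.

Lemma holds3_lift (E : nonstandard_extension) D A1 A2 A3 (P : A1 -> A2 -> A3 -> Prop)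
    (p1 : D -> A1) (p2 : D -> A2) (p3 : D -> A3) (c : star E D) :
  holds3 P (lift E p1 c) (lift E p2 c) (lift E p3 c) <->
  holds E (fun d => P (p1 d) (p2 d) (p3 d)) c.
Proof. unfold holds3. now rewrite tup_lift, holds2_lift. Qed.

Lemma star_x_node_lift (E : nonstandard_extension) D (n i : D -> nat) (c : star E D) :
  star_x_node (lift E n c) (lift E i c) = lift E (fun d => x_node (n d) (i d)) c.
Proof. apply lift2_lift. Qed.

Lemma star_t_node_lift (E : nonstandard_extension) D (n i : D -> nat) (c : star E D) :
  star_t_node (lift E n c) (lift E i c) = lift E (fun d => t_node (n d) (i d)) c.
Proof. apply lift2_lift. Qed.

(** Cyclic indices unite the three clauses of the discrete derivative. Since [holds] commutes with
    negation, the index at [c] is first, last or strictly between. *)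
Lemma discrete_derivative_cyclic (E : nonstandard_extension) D (c : star E D)
    (n i : D -> nat) (h h' : star E R -> star E C) :
  is_discrete_derivative (lift E n c) h h' ->
  holds E (fun d => (1 <= n d)%nat) c ->
  holds E (fun d => (i d <= 2 * n d - 1)%nat) c ->
  h' (lift E (fun d => x_node (n d) (i d)) c) =
  x_quotient (lift E n c)
    (h (lift E (fun d => x_node (n d) (next_index (n d) (i d))) c))
    (h (lift E (fun d => x_node (n d) (prev_index (n d) (i d))) c)).
Proof.
  intros [_ [hmid [hlast hfirst]]] hn hi.
  rewrite <- (lift_const E D R (- PI) c) in hlast, hfirst.
  rewrite !lift_lift in hlast, hfirst.
  destruct (classic (holds E (fun d => i d = O) c)) as [h0|h0];
    [|destruct (classic (holds E (fun d => i d = (2 * n d - 1)%nat) c)) as [h1|h1]].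
  - pose proof (proj2 (holds_and _ _ c) (conj hn h0)) as hc.
    assert (e0 : lift E (fun d => x_node (n d) (i d)) c = lift E (fun _ => - PI) c).
    { apply lift_eq. revert hc. apply holds_mono. intros d [a b]. rewrite b.
      unfold x_node. simpl. field. apply not_0_INR. lia. }
    assert (e1 : lift E (fun d => x_node (n d) (next_index (n d) (i d))) c
                 = lift E (fun d => - PI + PI / INR (n d)) c).
    { apply lift_eq. revert hc. apply holds_mono. intros d [a b]. rewrite b.
      unfold x_node, next_index. destruct (Nat.eqb_spec 0 (2 * n d - 1)); [lia|].
      simpl. field. apply not_0_INR. lia. }
    assert (e2 : lift E (fun d => x_node (n d) (prev_index (n d) (i d))) c
                 = lift E (fun d => PI - PI / INR (n d)) c).
    { apply lift_eq. revert hc. apply holds_mono. intros d [a b]. rewrite b.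
      unfold x_node, prev_index. rewrite Nat.eqb_refl.
      rewrite minus_INR, mult_INR by lia. simpl. field. apply not_0_INR. lia. }
    rewrite e0, e1, e2. exact hfirst.
  - pose proof (proj2 (holds_and _ _ c) (conj hn h1)) as hc.
    assert (e0 : lift E (fun d => x_node (n d) (i d)) c
                 = lift E (fun d => PI - PI / INR (n d)) c).
    { apply lift_eq. revert hc. apply holds_mono. intros d [a b]. rewrite b.
      unfold x_node. rewrite minus_INR, mult_INR by lia. simpl. field. apply not_0_INR. lia. }
    assert (e1 : lift E (fun d => x_node (n d) (next_index (n d) (i d))) c
                 = lift E (fun _ => - PI) c).
    { apply lift_eq. revert hc. apply holds_mono. intros d [a b]. rewrite b.
      unfold x_node, next_index. rewrite Nat.eqb_refl. simpl. field. apply not_0_INR. lia. }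
    assert (e2 : lift E (fun d => x_node (n d) (prev_index (n d) (i d))) c
                 = lift E (fun d => PI - 2 * PI / INR (n d)) c).
    { apply lift_eq. revert hc. apply holds_mono. intros d [a b]. rewrite b.
      unfold x_node, prev_index. destruct (Nat.eqb_spec (2 * n d - 1) 0); [lia|].
      rewrite !minus_INR, mult_INR by lia. simpl. field. apply not_0_INR. lia. }
    rewrite e0, e1, e2. exact hlast.
  - apply holds_not in h0, h1.
    pose proof (proj2 (holds_and _ _ c) (conj hi (proj2 (holds_and _ _ c) (conj h0 h1)))) as hc.
    specialize (hmid (lift E i c)). rewrite holds2_lift in hmid.
    rewrite !lift_lift, !star_x_node_lift in hmid. rewrite hmid.
    2: { revert hc. apply holds_mono. intros d [a [b b']]. lia. }
    f_equal; f_equal; apply lift_eq; revert hc; apply holds_mono; intros d [a [b b']].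
    + unfold next_index. now destruct (Nat.eqb_spec (i d) (2 * n d - 1)).
    + unfold prev_index. now destruct (Nat.eqb_spec (i d) 0).
Qed.

Lemma x_quotient_lift (E : nonstandard_extension) D (c : star E D) (n : D -> nat) (z w : D -> C) :
  x_quotient (lift E n c) (lift E z c) (lift E w c) =
  lift E (fun d => central_quotient (n d) (z d) (w d)) c.
Proof. apply lift3_lift. Qed.

Lemma t_quotient_lift (E : nonstandard_extension) D (c : star E D) (n : D -> nat) (z w : D -> C) :
  t_quotient (lift E n c) (lift E z c) (lift E w c) =
  lift E (fun d => forward_quotient (n d) (z d) (w d)) c.
Proof. apply lift3_lift. Qed.

Lemma t_node_range (m j : nat) :
  (1 <= m)%nat -> (j <= m ^ 2 - 1)%nat -> 0 <= t_node m j < INR m.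
Proof.
  intros hm hj. assert (hm0 : 0 < INR m) by (apply lt_0_INR; lia).
  unfold t_node. split; [apply Rdiv_le_0_compat; [apply pos_INR | exact hm0]|].
  apply Rlt_div_l; [exact hm0|]. rewrite <- mult_INR. apply lt_INR. simpl in hj. nia.
Qed.

Lemma discretization_node (n i : nat) :
  (1 <= n)%nat ->
  - PI + PI / INR n * IZR (Int_part (INR n * (x_node n i + PI) / PI)) = x_node n i.
Proof.
  intros hn. assert (hn0 : 0 < INR n) by (apply lt_0_INR; lia). pose proof PI_RGT_0.
  replace (INR n * (x_node n i + PI) / PI) with (INR i) by (unfold x_node; field; lra).
  rewrite Int_part_INR, <- INR_IZR_INZ. unfold x_node. field. lra.
Qed.

(** Internality of [F], phrased for arguments that are coordinates of [c]; allowing any [D] lets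
    quantified indices be adjoined as further coordinates. *)
Definition represents (E : nonstandard_extension) D (c : star E D) (m : D -> nat)
    (phi : D -> R * R -> C) (F : star E R -> star E R -> star E C) : Prop :=
  forall x t : D -> R, holds E (fun d => - PI <= x d < PI) c ->
    holds E (fun d => 0 <= t d < INR (m d)) c ->
    F (lift E x c) (lift E t c) = lift E (fun d => phi d (x d, t d)) c.

Lemma nonstandard_solution_initial (E : nonstandard_extension) D (c : star E D)
    (n m i : D -> nat) (phi : D -> R * R -> C) (g : R -> C)
    (F : star E R -> star E R -> star E C) :
  nonstandard_solution (lift E n c) (lift E m c) (discretization (lift E n c) g) F ->
  represents E D c m phi F ->
  holds E (fun d => (1 <= n d)%nat) c -> holds E (fun d => (2 <= m d)%nat) c ->
  holds E (fun d => (i d <= 2 * n d - 1)%nat) c ->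
  holds E (fun d => phi d (x_node (n d) (i d), 0) = g (x_node (n d) (i d))) c.
Proof.
  intros [_ [_ hF]] hphi hn hm hi.
  assert (hx : holds E (fun d => - PI <= x_node (n d) (i d) < PI) c).
  { generalize (proj2 (holds_and _ _ c) (conj hn hi)). apply holds_mono.
    intros d [a b]. now apply x_node_range. }
  specialize (hF (lift E (fun d => x_node (n d) (i d)) c)).
  unfold in_V in hF. rewrite holds_lift in hF. specialize (hF hx).
  rewrite <- (lift_const E D R 0 c) in hF. rewrite (hphi _ (fun _ => 0)) in hF.
  - unfold discretization in hF. rewrite lift2_lift, lift_lift in hF.
    apply lift_eq in hF. generalize (proj2 (holds_and _ _ c) (conj hn hF)).
    apply holds_mono. intros d [a b]. now rewrite b, discretization_node.
  - exact hx.
  - revert hm. apply holds_mono. intros d a.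
    assert (0 < INR (m d)) by (apply lt_0_INR; lia). lra.
Qed.

Lemma nonstandard_solution_step (E : nonstandard_extension) D (c : star E D)
    (n m i j : D -> nat) (phi : D -> R * R -> C) f
    (F : star E R -> star E R -> star E C) :
  nonstandard_solution (lift E n c) (lift E m c) f F ->
  represents E D c m phi F ->
  holds E (fun d => (1 <= n d)%nat) c -> holds E (fun d => (2 <= m d)%nat) c ->
  holds E (fun d => (i d <= 2 * n d - 1)%nat) c ->
  holds E (fun d => (j d <= m d ^ 2 - 2)%nat) c ->
  holds E (fun d =>
     forward_quotient (m d) (phi d (x_node (n d) (i d), t_node (m d) (j d + 1)))
       (phi d (x_node (n d) (i d), t_node (m d) (j d))) =
     central_quotient (n d)
       (central_quotient (n d)
          (phi d (x_node (n d) (next_index (n d) (next_index (n d) (i d))), t_node (m d) (j d)))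
          (phi d (x_node (n d) (prev_index (n d) (next_index (n d) (i d))), t_node (m d) (j d))))
       (central_quotient (n d)
          (phi d (x_node (n d) (next_index (n d) (prev_index (n d) (i d))), t_node (m d) (j d)))
          (phi d (x_node (n d) (prev_index (n d) (prev_index (n d) (i d))), t_node (m d) (j d))))) c.
Proof.
  intros [_ [[Fx [Fxx [Ft [hFx [hFxx [[_ hFt] hheat]]]]]] _]] hphi hn hm hi hj.
  assert (next_le : forall k : D -> nat, holds E (fun d => (k d <= 2 * n d - 1)%nat) c ->
    holds E (fun d => (next_index (n d) (k d) <= 2 * n d - 1)%nat) c).
  { intros k hk. generalize (proj2 (holds_and _ _ c) (conj hn hk)). apply holds_mono.
    intros d [a b]. now apply next_prev_index. }
  assert (prev_le : forall k : D -> nat, holds E (fun d => (k d <= 2 * n d - 1)%nat) c ->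
    holds E (fun d => (prev_index (n d) (k d) <= 2 * n d - 1)%nat) c).
  { intros k hk. generalize (proj2 (holds_and _ _ c) (conj hn hk)). apply holds_mono.
    intros d [a b]. now apply next_prev_index. }
  assert (hV : forall k : D -> nat, holds E (fun d => (k d <= 2 * n d - 1)%nat) c ->
    holds E (fun d => - PI <= x_node (n d) (k d) < PI) c).
  { intros k hk. generalize (proj2 (holds_and _ _ c) (conj hn hk)). apply holds_mono.
    intros d [a b]. now apply x_node_range. }
  pose proof (proj2 (holds_and _ _ c) (conj hm hj)) as hmj.
  assert (hT : holds E (fun d => 0 <= t_node (m d) (j d) < INR (m d)) c).
  { revert hmj. apply holds_mono. intros d [a b]. apply t_node_range; lia. }
  (* With [m >= 2], [m ^ 2 - 2] is not truncated, so level [j + 1] is still a time level. *)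
  assert (hT1 : holds E (fun d => 0 <= t_node (m d) (j d + 1) < INR (m d)) c).
  { revert hmj. apply holds_mono. intros d [a b]. apply t_node_range; [lia|].
    assert (4 <= m d ^ 2)%nat by (simpl; nia). lia. }
  (* The node of level [j] lies strictly before the last time cell, on which the equation is not
     imposed. *)
  assert (hlast : ~ holds2 (fun k s => INR k - 1 / INR k <= s < INR k)
            (lift E m c) (lift E (fun d => t_node (m d) (j d)) c)).
  { rewrite holds2_lift, <- holds_not. revert hmj. apply holds_mono. intros d [a b] [h1 _].
    assert (hm0 : 0 < INR (m d)) by (apply lt_0_INR; lia).
    assert (4 <= m d ^ 2)%nat by (simpl; nia).
    unfold t_node in h1. apply Rle_div_r in h1; [|exact hm0].
    replace ((INR (m d) - 1 / INR (m d)) * INR (m d)) with (INR (m d) ^ 2 - 1) in h1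
      by (field; lra).
    assert (hj' : (j d + 1 < m d ^ 2)%nat) by lia. apply lt_INR in hj'.
    rewrite plus_INR, pow_INR in hj'. simpl (INR 1) in hj'. lra. }
  assert (hTin : in_T (lift E m c) (lift E (fun d => t_node (m d) (j d)) c)).
  { unfold in_T. now apply holds2_lift. }
  assert (hVin : in_V (lift E (fun d => x_node (n d) (i d)) c)).
  { unfold in_V. rewrite holds_lift. now apply hV. }
  specialize (hheat _ _ hVin hTin hlast).
  destruct (hFt _ hVin) as [hFt1 _]. specialize (hFt1 (lift E j c)).
  rewrite holds2_lift, !lift_lift, !star_t_node_lift in hFt1. specialize (hFt1 hj).
  rewrite hheat in hFt1.
  specialize (hFx _ hTin). specialize (hFxx _ hTin).
  rewrite (discrete_derivative_cyclic E D c n i _ _ hFxx hn hi) in hFt1.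
  cbv beta in hFt1.
  rewrite (discrete_derivative_cyclic E D c n (fun d => next_index (n d) (i d)) _ _ hFx hn)
    in hFt1 by auto.
  rewrite (discrete_derivative_cyclic E D c n (fun d => prev_index (n d) (i d)) _ _ hFx hn)
    in hFt1 by auto.
  rewrite !hphi in hFt1 by auto.
  rewrite t_quotient_lift, !x_quotient_lift in hFt1.
  apply lift_eq. symmetry. exact hFt1.
Qed.

(** The quantifiers over [i] and [j] become quantifiers over [star E nat]. Each hyperfinite index is
    paired with [c], and the hypotheses are pulled back along the projection. *)
Lemma nonstandard_solution_grid (E : nonstandard_extension) D (c : star E D)
    (n m : D -> nat) (phi : D -> R * R -> C) (g : R -> C)
    (F : star E R -> star E R -> star E C) :
  nonstandard_solution (lift E n c) (lift E m c) (discretization (lift E n c) g) F ->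
  (forall x t, in_V x -> in_T (lift E m c) t ->
     F x t = internal_app (lift E phi c) (tup E x t)) ->
  holds E (fun d => (1 <= n d)%nat) c -> holds E (fun d => (2 <= m d)%nat) c ->
  holds E (fun d => grid_solution g (n d) (m d) (phi d)) c.
Proof.
  intros hF hphi hn hm.
  assert (hrep : forall D' (c' : star E D') (p : D' -> D), c = lift E p c' ->
            represents E D' c' (fun d => m (p d)) (fun d => phi (p d)) F).
  { intros D' c' p -> x t hx ht.
    rewrite hphi.
    - unfold internal_app. now rewrite lift_lift, tup_lift, lift2_lift.
    - unfold in_V. now rewrite holds_lift.
    - unfold in_T. rewrite lift_lift. now apply holds2_lift. }
  unfold grid_solution. apply holds_and. split.
  - apply holds_forall. intros b. apply holds_impl. intros hb.
    set (c' := tup E c b) in *.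
    assert (ec : c = lift E fst c') by (symmetry; apply lift_fst).
    specialize (hrep _ c' fst ec). rewrite ec, holds_lift in hn, hm. rewrite ec, !lift_lift in hF.
    exact (nonstandard_solution_initial E _ c' (fun d => n (fst d)) (fun d => m (fst d)) snd
             (fun d => phi (fst d)) g F hF hrep hn hm hb).
  - apply holds_forall. intros b.
    apply (holds_forall E _ nat (fun p k => (snd p <= 2 * n (fst p) - 1)%nat -> _)).
    intros b'. apply holds_impl. intros hb. apply holds_impl. intros hb'.
    set (c' := tup E (tup E c b) b') in *.
    assert (ec : c = lift E (fun d => fst (fst d)) c').
    { unfold c'. now rewrite <- (lift_lift E _ _ _ fst fst), !lift_fst. }
    specialize (hrep _ c' (fun d => fst (fst d)) ec). rewrite ec, holds_lift in hn, hm. rewrite ec, !lift_lift in hF.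
    exact (nonstandard_solution_step E _ c' (fun d => n (fst (fst d))) (fun d => m (fst (fst d)))
             (fun d => snd (fst d)) snd
             (fun d => phi (fst (fst d))) _ F hF hrep hn hm hb hb').
Qed.

(** * Infinite indices, standard parts and the conclusion *)

Lemma infinite_nat_ge (E : nonstandard_extension) (n : star E nat) :
  infinite_nat n -> forall N, holds E (fun k => (N <= k)%nat) n.
Proof.
  (* The induction is on the standard [N]: an element that is at least [N] and differs from [N] is
     at least [N + 1]. *)
  intros hn N. induction N as [|N IH].
  - apply holds_of_forall. intros k. lia.
  - assert (hN : holds E (fun k => k <> N) n).
    { apply holds_not. intros h. apply (hn N).
      rewrite <- (lift_id n), <- (lift_const E nat nat N n). now apply lift_eq. }
    generalize (proj2 (holds_and _ _ n) (conj IH hN)). apply holds_mono.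
    intros k [a b]. lia.
Qed.

(** The standard part is the supremum of the standard reals below [x]. *)
Lemma standard_part_exists (E : nonstandard_extension) (x : star E R) :
  finite_hyperreal x -> exists r, is_standard_part x r.
Proof.
  intros [M hM].
  set (S := fun r => holds E (fun y => r <= y) x).
  destruct (completeness S) as [r [hub hlub]].
  - exists M. intros s hs. apply Rnot_lt_le. intros hlt.
    refine (holds_incompatible E _ _ _ x _ hM hs).
    intros y a b. apply Rabs_le_between in a. lra.
  - exists (- M). unfold S. revert hM. apply holds_mono. intros y a.
    apply Rabs_le_between in a. lra.
  - exists r. intros eps heps.
    assert (h1 : holds E (fun y => ~ r + eps / 2 <= y) x).
    { apply holds_not. intros h. specialize (hub (r + eps / 2) h). lra. }
    assert (h2 : holds E (fun y => r - eps / 2 <= y) x).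
    { apply NNPP. intros h. apply holds_not in h.
      assert (r <= r - eps / 2); [|lra].
      apply hlub. intros s hs. apply Rnot_lt_le. intros hlt.
      refine (holds_incompatible E _ _ _ x _ h hs).
      intros y a b. lra. }
    generalize (proj2 (holds_and _ _ x) (conj h1 h2)). apply holds_mono.
    intros y [a b]. apply Rabs_lt_between. lra.
Qed.

Lemma standard_part_ge (E : nonstandard_extension) (x : star E R) (r s : R) :
  is_standard_part x r -> holds E (fun y => s <= y) x -> s <= r.
Proof.
  intros hr hs. apply Rnot_lt_le. intros hlt.
  refine (holds_incompatible E _ _ _ x _ (hr (s - r) ltac:(lra)) hs).
  intros y a b. apply Rabs_lt_between in a. lra.
Qed.

Lemma standard_part_le (E : nonstandard_extension) (x : star E R) (r s : R) :
  is_standard_part x r -> holds E (fun y => y <= s) x -> r <= s.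
Proof.
  intros hr hs. apply Rnot_lt_le. intros hlt.
  refine (holds_incompatible E _ _ _ x _ (hr (r - s) ltac:(lra)) hs).
  intros y a b. apply Rabs_lt_between in a. lra.
Qed.

Lemma solution_at_cell_node (E : nonstandard_extension) D (c : star E D)
    (n m : D -> nat) (x t : D -> R) (F : star E R -> star E R -> star E C) :
  measurable_VT (lift E n c) (lift E m c) F ->
  holds E (fun d => (1 <= n d)%nat) c -> holds E (fun d => (1 <= m d)%nat) c ->
  holds E (fun d => - PI <= x d < PI) c -> holds E (fun d => 0 <= t d < INR (m d)) c ->
  F (lift E x c) (lift E t c) =
  F (lift E (fun d => x_node (n d) (x_index (n d) (x d))) c)
    (lift E (fun d => t_node (m d) (t_index (m d) (t d))) c).
Proof.
  intros [_ hF] hn hm hx ht.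
  pose proof (proj2 (holds_and _ _ c) (conj hn hx)) as hnx.
  pose proof (proj2 (holds_and _ _ c) (conj hm ht)) as hmt.
  apply (hF (lift E (fun d => x_index (n d) (x d)) c) (lift E (fun d => t_index (m d) (t d)) c));
    split; rewrite ?holds2_lift, ?holds3_lift; revert hnx; revert hmt.
  all: intros hmt hnx.
  1, 2, 3, 4: revert hnx.
  5, 6, 7, 8: revert hmt.
  all: apply holds_mono; intros d [a b].
  - now apply x_index_spec.
  - now apply x_index_spec.
  - now apply x_index_spec.
  - assert (hn0 : 0 < INR (n d)) by (apply lt_0_INR; lia). pose proof PI_RGT_0.
    split; [lra|]. unfold x_node. rewrite plus_INR.
    apply Rplus_lt_compat_l, Rmult_lt_compat_l; [lra|].
    apply Rmult_lt_compat_r; [now apply Rinv_0_lt_compat | simpl; lra].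
  - now apply t_index_spec.
  - now apply t_index_spec.
  - now apply t_index_spec.
  - assert (hm0 : 0 < INR (m d)) by (apply lt_0_INR; lia).
    split; [lra|]. unfold t_node. rewrite plus_INR.
    apply Rmult_lt_compat_r; [now apply Rinv_0_lt_compat | simpl; lra].
Qed.

(** For each standard [eps], infinite [eta], [nu] exceed the standard threshold, and [x], [t] lie
    within the standard radius of [(a, b)]. All hypotheses of [grid_solution_converges] then hold at
    [c], and its conclusion follows there by monotonicity. *)
Lemma nonstandard_heat_near (E : nonstandard_extension) D (c : star E D)
    (n m : D -> nat) (phi : D -> R * R -> C) (x t : D -> R)
    (g : R -> C) (G : R * R -> C) (F : star E R -> star E R -> star E C) (a b : R) :
  Cinf_circle g -> classical_solution g G -> T_dom (a, b) ->
  infinite_nat (lift E n c) -> infinite_nat (lift E m c) ->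
  holds E (fun d => INR (n d) <= PI * sqrt (2 * INR (m d))) c ->
  nonstandard_solution (lift E n c) (lift E m c) (discretization (lift E n c) g) F ->
  (forall x t, in_V x -> in_T (lift E m c) t ->
     F x t = internal_app (lift E phi c) (tup E x t)) ->
  in_V (lift E x c) -> in_T (lift E m c) (lift E t c) ->
  is_standard_part (lift E x c) a -> is_standard_part (lift E t c) b ->
  is_standard_part_C (F (lift E x c) (lift E t c)) (G (a, b)).
Proof.
  intros hg hG hab hn hm hcfl hF hphi hx ht ha hb eps heps.
  destruct (grid_solution_converges g G a b eps hg hG hab heps) as [N [r [hr hconv]]].
  pose proof (infinite_nat_ge E _ hn (Nat.max N 2)) as hn'.
  pose proof (infinite_nat_ge E _ hm (Nat.max N 2)) as hm'.
  specialize (ha r hr). specialize (hb r hr).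
  unfold in_V in hx. unfold in_T in ht.
  rewrite holds_lift in hn', hm', ha, hb, hx. rewrite holds2_lift in ht.
  assert (hn1 : holds E (fun d => (1 <= n d)%nat) c).
  { revert hn'. apply holds_mono. intros d. lia. }
  assert (hm2 : holds E (fun d => (2 <= m d)%nat) c).
  { revert hm'. apply holds_mono. intros d. lia. }
  assert (hm1 : holds E (fun d => (1 <= m d)%nat) c).
  { revert hm2. apply holds_mono. intros d. lia. }
  pose proof (nonstandard_solution_grid E D c n m phi g F hF hphi hn1 hm2) as hgrid.
  rewrite (solution_at_cell_node E D c n m x t F (proj1 hF)) by assumption.
  rewrite hphi.
  - unfold internal_app. rewrite tup_lift, lift2_lift, holds_lift.
    generalize (conj hn' (conj hm' (conj hcfl (conj hgrid (conj hx (conj ht (conj ha hb))))))).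
    rewrite <- !holds_and. apply holds_mono.
    intros d [k1 [k2 [k3 [k4 [k5 [k6 [k7 k8]]]]]]].
    apply hconv; auto; lia.
  - unfold in_V. rewrite holds_lift. generalize (proj2 (holds_and _ _ c) (conj hn1 hx)).
    apply holds_mono. intros d [k1 k2]. apply x_node_range; [exact k1|].
    now apply x_index_spec.
  - unfold in_T. rewrite holds2_lift. generalize (proj2 (holds_and _ _ c) (conj hm1 ht)).
    apply holds_mono. intros d [k1 k2]. apply t_node_range; [exact k1|].
    now apply t_index_spec.
Qed.

Theorem theorem0p31
  (E : nonstandard_extension)
  (g : R -> C) (hg : Cinf_circle g)
  (G : R * R -> C) (hG : classical_solution g G)
  (eta nu : star E nat)
  (heta : infinite_nat eta) (hnu : infinite_nat nu)
  (hcfl : holds2 (fun n m => INR n <= PI * sqrt (2 * INR m)) eta nu)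
  (F : star E R -> star E R -> star E C)
  (hF : nonstandard_solution eta nu (discretization eta g) F) :
  forall x t : star E R, in_V x -> in_T nu t -> finite_hyperreal t ->
    exists a b : R, is_standard_part x a /\ is_standard_part t b /\
      is_standard_part_C (F x t) (G (a, b)).
Proof.
  intros x t hx ht hfin. pose proof PI_RGT_0 as hpi.
  destruct (standard_part_exists E x) as [a ha].
  { exists PI. revert hx. apply holds_mono. intros y hy. apply Rabs_le_between. lra. }
  destruct (standard_part_exists E t hfin) as [b hb].
  exists a, b. split; [exact ha | split; [exact hb|]].
  pose proof hF as [[[Phi hPhi] _] _].
  (* All internal data are packed into one element, so that each is the lift of a projection. *)
  set (c := tup E (tup E Phi (tup E eta nu)) (tup E x t)).
  assert (e1 : Phi = lift E (fun d => fst (fst d)) c).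
  { unfold c. now rewrite <- (lift_lift E _ _ _ fst fst), !lift_fst. }
  assert (e2 : eta = lift E (fun d => fst (snd (fst d))) c).
  { unfold c. rewrite <- (lift_lift E _ _ _ fst (fun z => fst (snd z))), lift_fst.
    now rewrite <- (lift_lift E _ _ _ snd fst), lift_snd, lift_fst. }
  assert (e3 : nu = lift E (fun d => snd (snd (fst d))) c).
  { unfold c. rewrite <- (lift_lift E _ _ _ fst (fun z => snd (snd z))), lift_fst.
    now rewrite <- (lift_lift E _ _ _ snd snd), !lift_snd. }
  assert (e4 : x = lift E (fun d => fst (snd d)) c).
  { unfold c. now rewrite <- (lift_lift E _ _ _ snd fst), lift_snd, lift_fst. }
  assert (e5 : t = lift E (fun d => snd (snd d)) c).
  { unfold c. now rewrite <- (lift_lift E _ _ _ snd snd), !lift_snd. }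
  (* Only weak inequalities survive taking standard parts: [a] may equal [PI], which the closed
     domain admits. *)
  assert (hab : T_dom (a, b)).
  { split; simpl; [split|].
    - apply (standard_part_ge E x); [exact ha|]. revert hx. apply holds_mono. intros; lra.
    - apply (standard_part_le E x); [exact ha|]. revert hx. apply holds_mono. intros; lra.
    - apply (standard_part_ge E t); [exact hb|]. rewrite e3, e5 in ht.
      unfold in_T in ht. rewrite holds2_lift in ht.
      rewrite e5, holds_lift. revert ht. apply holds_mono. intros; lra. }
  clearbody c. subst Phi eta nu x t.
  rewrite holds2_lift in hcfl.
  exact (nonstandard_heat_near E _ c _ _ _ _ _ g G F a b
    hg hG hab heta hnu hcfl hF hPhi hx ht ha hb).
Qed.
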